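(* Let $k$ be a field, let $\Lambda$ be a finite dimensional basic split $k$-algebra, let $\tilde{\mathcal{S}}_\Lambda$ be the enlarged species of $\Lambda$, and let $\tilde J$ be the ideal $\bigoplus_{j\ge1}\tilde M^{(j)}$ of $T(\tilde{\mathcal{S}}_\Lambda)$. Then $\Lambda\simeq T(\tilde{\mathcal{S}}_\Lambda)/\langle\rho\rangle$ for a set of relations $\rho$ on $\tilde{\mathcal{S}}_\Lambda$ such that $\tilde J^{\operatorname{rl}(\Lambda)}\subset\langle\rho\rangle\subset\tilde J$.
   Context: Algebras. $\mathfrak{r} = \operatorname{rad}\Lambda$ is the Jacobson radical. $\Lambda$ is basic if ${}_\Lambda\Lambda$ is a direct sum of pairwise non-isomorphic indecomposable projective left modules; then $\Lambda/\mathfrak{r} \simeq \bigoplus_{i\in I} D_i$ with $D_i$ division rings. $\operatorname{rl}(\Lambda)$ is the smallest $n$ with $\mathfrak{r}^n = (0)$. $\Lambda$ is split if there is a $k$-algebra homomorphism $\epsilon\colon \Lambda/\mathfrak{r} \to \Lambda$ with $\pi\epsilon = \operatorname{id}_{\Lambda/\mathfrak{r}}$, where $\pi\colon\Lambda\to\Lambda/\mathfrak{r}$ is the natural projection. Species. A $k$-species $\mathcal{S} = (D_i, {}_jM_i)_{i,j\in I}$ consists of division rings $D_i$, finite dimensional over a common central subfield $k$, and $D_j$-$D_i$-bimodules ${}_jM_i$, finite dimensional over $k$ with $\lambda m = m\lambda$ for $\lambda \in k$, $m\in {}_jM_i$. (Then automatically $\operatorname{Hom}_{D_i}({}_jM_i,D_i)\simeq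 \operatorname{Hom}_{D_j}({}_jM_i,D_j)$ as $D_i$-$D_j$-bimodules.) Its underlying quiver $Q_\mathcal{S}$ has vertex set $I$ and one arrow $i\to j$ for each ${}_jM_i\neq (0)$. Put $D = \bigoplus_i D_i$, $M = \bigoplus_{i,j} {}_jM_i$ (a $D$-$D$-bimodule), $M^{(0)} = D$, and $M^{(n)}$ the $n$-fold tensor product of $M$ over $D$. The tensor algebra is $T(\mathcal{S}) = \bigoplus_{n\ge 0} M^{(n)}$ with multiplication given by the tensor product. Relations. A relation on $\mathcal{S}$ starting in $a\in I$ and ending in $b\in I$ is a finite sum $\sigma = g_1+\cdots+g_n$ where each $g_l = g_{l,n_l}\otimes\cdots\otimes g_{l,1}$, $n_l\ge 1$, is an elementary tensor in ${}_{i_{n_l}}M_{i_{n_l-1}}\otimes_{D_{i_{n_l-1}}}\cdots\otimes_{D_{i_1}} {}_{i_1}M_{i_0}$ for some path $a=i_0\to i_1\to\cdots\to i_{n_l}=b$ (depending on $l$) in $Q_\mathcal{S}$. A set of relations is a set $\rho$ of relations (possibly with different start and end vertices); $\langle\rho\rangle$ is the two-sided ideal of $T(\mathcal{S})$ it generates. Enlarged species. $\mathfrak{r}/\mathfrak{r}^2$ is a $\Lambda/\mathfrak{r}$-$\Lambda/\mathfrak{r}$-bimodule in the natural way. Put ${}_jM_i=D_j(\mathfrak{r}/\mathfrak{r}^2)D_i$, ${}_j\tilde M_i=D_j\otimes_k{}_jM_i\otimes_kD_i$ and $\tilde M=\bigoplus_{i,j\in I}{}_j\tilde M_i$. The enlarged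 species of $\Lambda$ is $\tilde{\mathcal{S}}_\Lambda=(D_i,{}_j\tilde M_i)_{i,j\in I}$, so $T(\tilde{\mathcal{S}}_\Lambda)=\bigoplus_{n\ge0}\tilde M^{(n)}$, tensor powers being over $\Lambda/\mathfrak{r}$. *)

(* Defs.v *)
From HB Require Import structures.
From mathcomp Require Import all_boot all_algebra all_field.
From mathcomp Require Import boolp classical_sets.
From mathcomp Require Import freeg.

Set Implicit Arguments.
Unset Strict Implicit.
Unset Printing Implicit Defensive.

Import GRing.Theory.
Local Open Scope classical_set_scope.
Local Open Scope ring_scope.

Record subgroup (V : zmodType) := Subgroup {
  sgmem :> V -> Prop;
  sg0 : sgmem 0;
  sgB : forall x y, sgmem x -> sgmem y -> sgmem (x - y) }.
Definition sgset (V : zmodType) (H : subgroup V) : set V := [set x | H x].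
Coercion sgset : subgroup >-> set.

Section Subgroup.
Variables (V : zmodType) (H : subgroup V).

Lemma sgN x : H x -> H (- x).
Proof. by move=> Hx; rewrite -sub0r; apply: sgB => //; apply: sg0. Qed.

Lemma sgD x y : H x -> H y -> H (x + y).
Proof. by move=> Hx Hy; rewrite -[y]opprK; apply: sgB => //; apply: sgN. Qed.

Lemma sg_sum (J : Type) (r : seq J) (P : pred J) (F : J -> V) :
  (forall i, P i -> H (F i)) -> H (\sum_(i <- r | P i) F i).
Proof.
move=> HF; apply: (big_ind H) => //; first exact: sg0.
exact: sgD.
Qed.

Definition sgpred : {pred V} := fun x => `[< H x >].

Lemma sgpredE x : (x \in sgpred) = `[< H x >]. Proof. by []. Qed.

Lemma sgpred_closed : zmod_closed sgpred.
Proof.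
split; first by apply/asboolP; apply: sg0.
by move=> x y /asboolP Hx /asboolP Hy; apply/asboolP; apply: sgB.
Qed.
HB.instance Definition _ := GRing.isZmodClosed.Build V sgpred sgpred_closed.

Record sgtype := SgType { sgval :> V; sgvalP : sgval \in sgpred }.
HB.instance Definition _ := [isSub for sgval].
HB.instance Definition _ := [Choice of sgtype by <:].
HB.instance Definition _ := [SubChoice_isSubZmodule of sgtype by <:].

Lemma sgtypeP (x : sgtype) : H (sgval x).
Proof. by case: x => x /= /asboolP. Qed.

Definition to_sg x (Hx : H x) : sgtype := SgType (introT (asboolP _) Hx).

Lemma sgval_inj (x y : sgtype) : sgval x = sgval y -> x = y.
Proof. exact: val_inj. Qed.

Definition zquot := Quotient.quot sgpred.
HB.instance Definition _ := GRing.Zmodule.on zquot.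

Definition zproj (x : V) : zquot := (\pi_zquot x)%qT.
Definition zrepr (q : zquot) : V := repr q.

Lemma zprojD x y : zproj (x + y) = zproj x + zproj y.
Proof. by rewrite /zproj !piE. Qed.

Lemma zproj_eq x y : zproj x = zproj y <-> H (x - y).
Proof.
rewrite /zproj; split => [/eqP|Hxy].
  by rewrite -Quotient.idealrBE => /asboolP.
by apply/eqP; rewrite -Quotient.idealrBE; apply/asboolP.
Qed.

Lemma zreprK q : zproj (zrepr q) = q. Proof. exact: reprK. Qed.

Lemma zproj_repr x : H (zrepr (zproj x) - x).
Proof. by apply/zproj_eq; rewrite zreprK. Qed.

Lemma zproj0 : zproj 0 = 0.
Proof. by apply: (addrI (zproj 0)); rewrite -zprojD !addr0. Qed.

Lemma zprojN x : zproj (- x) = - zproj x.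
Proof. by apply: (addrI (zproj x)); rewrite -zprojD !subrr zproj0. Qed.

Lemma zprojB x y : zproj (x - y) = zproj x - zproj y.
Proof. by rewrite zprojD zprojN. Qed.

End Subgroup.

Section GeneratedSubgroup.
Variables (V : zmodType) (X : set V).

Definition gen_sg_set : set V :=
  [set x | forall H : subgroup V, X `<=` H -> H x].

Lemma gen_sg_closed x y : gen_sg_set x -> gen_sg_set y -> gen_sg_set (x - y).
Proof. by move=> Hx Hy H XH; apply: sgB; [apply: Hx|apply: Hy]. Qed.

Definition gen_sg : subgroup V :=
  @Subgroup V gen_sg_set (fun H _ => sg0 H) gen_sg_closed.

End GeneratedSubgroup.

Record ideal (R : pzRingType) := Ideal {
  idealsg :> subgroup R;
  idealMl : forall a x, idealsg x -> idealsg (a * x);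
  idealMr : forall x a, idealsg x -> idealsg (x * a) }.

Definition rquot (R : pzRingType) (I : ideal R) := zquot I.

Section QuotientRing.
Variables (R : pzRingType) (I : ideal R).
HB.instance Definition _ := GRing.Zmodule.on (rquot I).

Definition rproj (x : R) : rquot I := zproj I x.
Definition rquot_mul (p q : rquot I) : rquot I := rproj (zrepr p * zrepr q).

Lemma rproj_mul x y : rquot_mul (rproj x) (rproj y) = rproj (x * y).
Proof.
apply/zproj_eq; set a := zrepr _; set b := zrepr _.
have -> : a * b - x * y = (a - x) * b + x * (b - y).
  by rewrite mulrBl mulrBr addrA subrK.
apply: sgD; first by apply: idealMr; apply: zproj_repr.
by apply: idealMl; apply: zproj_repr.
Qed.

Lemma rprojD x y : rproj (x + y) = rproj x + rproj y.
Proof. exact: zprojD. Qed.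

Lemma rprojK p : rproj (zrepr p) = p. Proof. exact: zreprK. Qed.

Fact rquot_mulA : associative rquot_mul.
Proof.
move=> x y z; rewrite -[x]rprojK -[y]rprojK -[z]rprojK.
by rewrite !rproj_mul mulrA.
Qed.
Fact rquot_mul1 : left_id (rproj 1) rquot_mul.
Proof. by move=> x; rewrite -[x]rprojK rproj_mul mul1r. Qed.
Fact rquot_mulr1 : right_id (rproj 1) rquot_mul.
Proof. by move=> x; rewrite -[x]rprojK rproj_mul mulr1. Qed.
Fact rquot_mulDl : left_distributive rquot_mul +%R.
Proof.
move=> x y z; rewrite -[x]rprojK -[y]rprojK -[z]rprojK.
by rewrite -rprojD !rproj_mul -rprojD mulrDl.
Qed.
Fact rquot_mulDr : right_distributive rquot_mul +%R.
Proof.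
move=> x y z; rewrite -[x]rprojK -[y]rprojK -[z]rprojK.
by rewrite -rprojD !rproj_mul -rprojD mulrDr.
Qed.
HB.instance Definition _ := GRing.Zmodule_isPzRing.Build (rquot I)
  rquot_mulA rquot_mul1 rquot_mulr1 rquot_mulDl rquot_mulDr.

Lemma rprojM x y : rproj (x * y) = rproj x * rproj y.
Proof. by rewrite -rproj_mul. Qed.
Lemma rproj1 : rproj 1 = 1. Proof. by []. Qed.
Lemma rproj_eq x y : rproj x = rproj y <-> I (x - y).
Proof. exact: zproj_eq. Qed.

End QuotientRing.

Section QuotientAlgebra.
Variables (k : fieldType) (A : algType k) (I : ideal A).

Definition rquot_scale (c : k) (p : rquot I) : rquot I :=
  rproj I (c *: zrepr p).

Lemma rproj_scale c x : rquot_scale c (rproj I x) = rproj I (c *: x).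
Proof.
apply/rproj_eq; rewrite -scalerBr -mulr_algl.
by apply: idealMl; apply: zproj_repr.
Qed.

Fact rquot_scaleA a b v :
  rquot_scale a (rquot_scale b v) = rquot_scale (a * b) v.
Proof. by rewrite -[v](rprojK (I := I)) !rproj_scale scalerA. Qed.
Fact rquot_scale1 : left_id 1 rquot_scale.
Proof. by move=> v; rewrite -[v](rprojK (I := I)) rproj_scale scale1r. Qed.
Fact rquot_scaleDr : right_distributive rquot_scale +%R.
Proof.
move=> a u v; rewrite -[v](rprojK (I := I)) -[u](rprojK (I := I)).
by rewrite -rprojD !rproj_scale -rprojD scalerDr.
Qed.
Fact rquot_scaleDl v : {morph rquot_scale^~ v : a b / a + b}.
Proof.
move=> a b; rewrite -[v](rprojK (I := I)).
by rewrite !rproj_scale -rprojD scalerDl.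
Qed.
HB.instance Definition _ := GRing.Zmodule_isLmodule.Build k (rquot I)
  rquot_scaleA rquot_scale1 rquot_scaleDr rquot_scaleDl.

Lemma rprojZ c x : rproj I (c *: x) = c *: rproj I x.
Proof. by rewrite -rproj_scale. Qed.

End QuotientAlgebra.

Section GeneratedIdeal.
Variables (R : pzRingType) (X : set R).

Definition gen_ideal_set : set R :=
  [set x | forall I : ideal R, X `<=` I -> I x].

Fact gen_ideal_B x y :
  gen_ideal_set x -> gen_ideal_set y -> gen_ideal_set (x - y).
Proof. by move=> Hx Hy I XI; apply: sgB; [apply: Hx|apply: Hy]. Qed.

Definition gen_ideal_sg : subgroup R :=
  @Subgroup R gen_ideal_set (fun I _ => sg0 I) gen_ideal_B.

Definition gen_ideal : ideal R :=
  @Ideal R gen_ideal_sg (fun a x Hx I XI => idealMl a (Hx I XI))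
    (fun x a Hx I XI => idealMr a (Hx I XI)).

End GeneratedIdeal.

Section IdealPowers.
Variable R : pzRingType.

Definition iprod (X Y : set R) : set R :=
  [set z | exists n (x y : 'I_n -> R),
     (forall l, X (x l) /\ Y (y l)) /\ z = \sum_l x l * y l].

(* For an ideal [X], this is the usual power [X^n], with [X^0] the ring. *)
Fixpoint ipow (X : set R) (n : nat) : set R :=
  if n is m.+1 then iprod X (ipow X m) else setT.

Lemma iprod_subgroup (I : subgroup R) (Y : set R) x y :
  iprod I Y x -> iprod I Y y -> iprod I Y (x - y).
Proof.
move=> [n [a [b [Hab ->]]]] [m [c [d [Hcd ->]]]].
exists (n + m)%N,
  (fun l => match split l with inl i => a i | inr j => - c j end),
  (fun l => match split l with inl i => b i | inr j => d j end).
split.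
  move=> l; case: (split l) => [i|j]; first exact: Hab.
  by have [Hc Hd] := Hcd j; split=> //; apply: sgN.
rewrite big_split_ord /= -sumrN; congr (_ + _); apply: eq_bigr => i _.
  by rewrite (unsplitK (inl i)).
by rewrite (unsplitK (inr i)) mulNr.
Qed.

Lemma iprod_incl (X Y : set R) x y : X x -> Y y -> iprod X Y (x * y).
Proof.
by move=> Xx Yy; exists 1%N, (fun=> x), (fun=> y); rewrite big_ord1.
Qed.

Lemma iprod0 (X Y : set R) : iprod X Y 0.
Proof.
exists 0%N, (fun=> 0), (fun=> 0); split; first by case.
by rewrite big_ord0.
Qed.

End IdealPowers.

Section Jacobson.
Variable R : pzRingType.

Definition left_ideal (J : set R) : Prop :=
  [/\ J 0, forall x y, J x -> J y -> J (x - y) & forall a x, J x -> J (a * x)].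

Definition maximal_left_ideal (J : set R) : Prop :=
  [/\ left_ideal J, J <> setT &
      forall K : set R, left_ideal K -> J `<=` K -> K = J \/ K = setT].

Definition jacobson : set R :=
  [set x | forall J, maximal_left_ideal J -> J x].

Fact jacobson0 : jacobson 0. Proof. by move=> J [[]]. Qed.
Fact jacobsonB x y : jacobson x -> jacobson y -> jacobson (x - y).
Proof.
by move=> Hx Hy J mJ; have [[_ JB _] _ _] := mJ; apply: JB; [apply: Hx|apply: Hy].
Qed.
Fact jacobsonMl a x : jacobson x -> jacobson (a * x).
Proof. by move=> Hx J mJ; have [[_ _ JM] _ _] := mJ; apply: JM; apply: Hx. Qed.

Fact jacobsonMr x a : jacobson x -> jacobson (x * a).
Proof.
move=> Hx J mJ; have [[J0 JB JM] JT maxJ] := mJ.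
have [Ja|nJa] := pselect (J a); first exact: JM.
apply: (Hx [set z | J (z * a)]); split.
- split => /= [|u v|u v]; rewrite ?mul0r ?mulrBl //; first exact: JB.
  by rewrite -mulrA; apply: JM.
- move=> E; apply: nJa.
  have : [set z | J (z * a)] 1 by rewrite E.
  by rewrite /= mul1r.
move=> K [K0 KB KM] sub.
have JD u v : J u -> J v -> J (u + v).
  by move=> Ju Jv; rewrite -[v]opprK -[- v]sub0r; apply: (JB) => //; apply: JB.
pose L : set R := [set z | exists l m, [/\ K l, J m & z = l * a + m]].
have idL : left_ideal L.
  split.
  - by exists 0, 0; rewrite mul0r addr0.
  - move=> _ _ [l [m [Kl Jm ->]]] [l' [m' [Kl' Jm' ->]]].
    exists (l - l'), (m - m'); split; [exact: KB|exact: JB|].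
    by rewrite mulrBl opprD addrACA.
  - move=> b _ [l [m [Kl Jm ->]]]; exists (b * l), (b * m).
    by split; [exact: KM|exact: JM|rewrite mulrDr mulrA].
have JL : J `<=` L by move=> m Jm; exists 0, m; rewrite mul0r add0r.
have [EL|EL] := maxJ L idL JL; [left|right].
  apply/seteqP; split=> // l Kl /=; rewrite -EL.
  by exists l, 0; rewrite addr0.
have [l [m [Kl Jm Ea]]] : L a by rewrite EL.
apply/seteqP; split=> // z _.
have K1l : K (1 - l) by apply: sub; rewrite /= mulrBl mul1r {1}Ea addrC addKr.
have K1 : K 1.
  have -> : 1 = 1 - l - (0 - l) by rewrite sub0r opprK subrK.
  by apply: (KB) => //; apply: KB.
by rewrite -[z]mulr1; apply: KM.
Qed.

Definition rad : ideal R :=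
  @Ideal R (@Subgroup R jacobson jacobson0 jacobsonB) jacobsonMl jacobsonMr.

End Jacobson.

Arguments rad R : clear implicits.
Arguments jacobson R : clear implicits.

(* The least [n] with [rad^n = 0]; the [else] branch is never taken for a
   finite-dimensional algebra, where the radical is nilpotent. *)
Definition rl (R : pzRingType) : nat :=
  if pselect (exists n, `[< ipow (jacobson R) n = [set 0] >]) is left e
  then ex_minn e else 0%N.

(* For a finite [I], the direct sum of the [V i]. *)
Definition fprod (I : Type) (V : I -> Type) := forall i, V i.

Section ProdZmod.
Variables (I : Type) (V : I -> zmodType).
Local Notation P := (fprod (fun i => V i)).
HB.instance Definition _ := gen_eqMixin P.
HB.instance Definition _ := gen_choiceMixin P.
Definition fprod0 : P := fun i => 0.
Definition fprod_opp (x : P) : P := fun i => - x i.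
Definition fprod_add (x y : P) : P := fun i => x i + y i.
Fact fprod_addA : associative fprod_add.
Proof. by move=> x y z; apply: functional_extensionality_dep => i; apply: addrA. Qed.
Fact fprod_addC : commutative fprod_add.
Proof. by move=> x y; apply: functional_extensionality_dep => i; apply: addrC. Qed.
Fact fprod_add0 : left_id fprod0 fprod_add.
Proof. by move=> x; apply: functional_extensionality_dep => i; apply: add0r. Qed.
Fact fprod_addN : left_inverse fprod0 fprod_opp fprod_add.
Proof. by move=> x; apply: functional_extensionality_dep => i; apply: addNr. Qed.
HB.instance Definition _ :=
  GRing.isZmodule.Build P fprod_addA fprod_addC fprod_add0 fprod_addN.
End ProdZmod.

Section ProdRing.
Variables (I : Type) (V : I -> pzRingType).
Local Notation P := (fprod (fun i => V i)).
Definition fprod1 : P := fun i => 1.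
Definition fprod_mul (x y : P) : P := fun i => x i * y i.
Fact fprod_mulA : associative fprod_mul.
Proof. by move=> x y z; apply: functional_extensionality_dep => i; apply: mulrA. Qed.
Fact fprod_mul1 : left_id fprod1 fprod_mul.
Proof. by move=> x; apply: functional_extensionality_dep => i; apply: mul1r. Qed.
Fact fprod_mulr1 : right_id fprod1 fprod_mul.
Proof. by move=> x; apply: functional_extensionality_dep => i; apply: mulr1. Qed.
Fact fprod_mulDl : left_distributive fprod_mul +%R.
Proof. by move=> x y z; apply: functional_extensionality_dep => i; apply: mulrDl. Qed.
Fact fprod_mulDr : right_distributive fprod_mul +%R.
Proof. by move=> x y z; apply: functional_extensionality_dep => i; apply: mulrDr. Qed.
HB.instance Definition _ := GRing.Zmodule_isPzRing.Build P
  fprod_mulA fprod_mul1 fprod_mulr1 fprod_mulDl fprod_mulDr.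
End ProdRing.

Section ProdLmod.
Variables (R : pzRingType) (I : Type) (V : I -> lmodType R).
Local Notation P := (fprod (fun i => V i)).
Definition fprod_scale (c : R) (x : P) : P := fun i => c *: x i.
Fact fprod_scaleA a b v : fprod_scale a (fprod_scale b v) = fprod_scale (a * b) v.
Proof. by apply: functional_extensionality_dep => i; apply: scalerA. Qed.
Fact fprod_scale1 : left_id 1 fprod_scale.
Proof. by move=> v; apply: functional_extensionality_dep => i; apply: scale1r. Qed.
Fact fprod_scaleDr : right_distributive fprod_scale +%R.
Proof. by move=> a u v; apply: functional_extensionality_dep => i; apply: scalerDr. Qed.
Fact fprod_scaleDl v : {morph fprod_scale^~ v : a b / a + b}.
Proof. by move=> a b; apply: functional_extensionality_dep => i; apply: scalerDl. Qed.
HB.instance Definition _ := GRing.Zmodule_isLmodule.Build R P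
  fprod_scaleA fprod_scale1 fprod_scaleDr fprod_scaleDl.
End ProdLmod.

Section ProdInj.
Variables (I : eqType) (V : I -> zmodType).
Definition finj (i : I) (x : V i) : fprod (fun i => V i) :=
  dfwith (fun j => 0 : V j) x.

Lemma finjE i (x : V i) : finj x i = x. Proof. exact: dfwith_in. Qed.
Lemma finj_out i j (x : V i) : i != j -> finj x j = 0.
Proof. exact: dfwith_out. Qed.
End ProdInj.

Record bimod (B A : pzRingType) := Bimod {
  bcar :> zmodType;
  lact : B -> bcar -> bcar;
  ract : bcar -> A -> bcar;
  lactDl : forall b b' x, lact (b + b') x = lact b x + lact b' x;
  lactDr : forall b x y, lact b (x + y) = lact b x + lact b y;
  lact1 : forall x, lact 1 x = x;
  lactM : forall b b' x, lact (b * b') x = lact b (lact b' x);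
  ractDl : forall x y a, ract (x + y) a = ract x a + ract y a;
  ractDr : forall x a a', ract x (a + a') = ract x a + ract x a';
  ract1 : forall x, ract x 1 = x;
  ractM : forall x a a', ract x (a * a') = ract (ract x a) a';
  lractA : forall b x a, ract (lact b x) a = lact b (ract x a) }.

Arguments lact : simpl never.
Arguments ract : simpl never.

Section BimodTheory.
Variables (B A : pzRingType) (M : bimod B A).

Lemma lact0 b : lact b (0 : M) = 0.
Proof. by apply: (addrI (lact b 0)); rewrite -lactDr !addr0. Qed.
Lemma lact0l (x : M) : lact 0 x = 0.
Proof. by apply: (addrI (lact 0 x)); rewrite -lactDl !addr0. Qed.
Lemma ract0 a : ract (0 : M) a = 0.
Proof. by apply: (addrI (ract 0 a)); rewrite -ractDl !addr0. Qed.
Lemma ract0r (x : M) : ract x 0 = 0.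
Proof. by apply: (addrI (ract x 0)); rewrite -ractDr !addr0. Qed.
Lemma lactN b (x : M) : lact b (- x) = - lact b x.
Proof. by apply: (addrI (lact b x)); rewrite -lactDr !subrr lact0. Qed.
Lemma lactNl b (x : M) : lact (- b) x = - lact b x.
Proof. by apply: (addrI (lact b x)); rewrite -lactDl !subrr lact0l. Qed.
Lemma ractN (x : M) a : ract (- x) a = - ract x a.
Proof. by apply: (addrI (ract x a)); rewrite -ractDl !subrr ract0. Qed.
Lemma lact_sum (J : Type) (r : seq J) (P : pred J) b (F : J -> M) :
  lact b (\sum_(i <- r | P i) F i) = \sum_(i <- r | P i) lact b (F i).
Proof. exact: (big_morph _ (lactDr b) (lact0 b)). Qed.
Lemma ract_sum (J : Type) (r : seq J) (P : pred J) a (F : J -> M) :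
  ract (\sum_(i <- r | P i) F i) a = \sum_(i <- r | P i) ract (F i) a.
Proof.
by apply: (big_morph (fun x => ract x a)) => [x y|]; rewrite ?ractDl ?ract0.
Qed.

End BimodTheory.

Definition bimod_reg (R : pzRingType) : bimod R R :=
  @Bimod R R R *%R *%R (fun b b' x => mulrDl b b' x) (fun b x y => mulrDr b x y)
    (@mul1r R) (fun b b' x => esym (mulrA b b' x)) (fun x y a => mulrDl x y a)
    (fun x a a' => mulrDr x a a') (@mulr1 R) (fun x a a' => mulrA x a a')
    (fun b x a => esym (mulrA b x a)).

Section Restriction.
Variables (B A B' A' : pzRingType) (f : {rmorphism B' -> B}).
Variables (g : {rmorphism A' -> A}) (M : bimod B A).

Definition bimod_res : bimod B' A'.
Proof.
apply: (@Bimod B' A' M (fun b x => lact (f b) x) (fun x a => ract x (g a))).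
- by move=> b b' x; rewrite rmorphD lactDl.
- by move=> b x y; rewrite lactDr.
- by move=> x; rewrite rmorph1 lact1.
- by move=> b b' x; rewrite rmorphM lactM.
- by move=> x y a; rewrite ractDl.
- by move=> x a a'; rewrite rmorphD ractDr.
- by move=> x; rewrite rmorph1 ract1.
- by move=> x a a'; rewrite rmorphM ractM.
- by move=> b x a; rewrite lractA.
Defined.

End Restriction.

Section Tensor.
Variables (B A C : pzRingType) (M : bimod B A) (N : bimod A C).

Local Notation F := {freeg (bcar M * bcar N)%type / int}.
Local Notation pt x y := (<< (x, y) >> : F).

Definition tens_rel : set F :=
  [set t | [\/ exists x x' y, t = pt (x + x') y - pt x y - pt x' y,
               exists x y y', t = pt x (y + y') - pt x y - pt x y' |
               exists x a y, t = pt (ract x a) y - pt x (lact a y)]].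

Definition tens_sub : subgroup F := gen_sg tens_rel.

Definition tens_car := zquot tens_sub.
HB.instance Definition _ := GRing.Zmodule.on tens_car.

Definition pure (x : M) (y : N) : tens_car := zproj tens_sub (pt x y).

Lemma tens_rel0 t : tens_rel t -> zproj tens_sub t = 0.
Proof.
move=> Ht; rewrite -(zproj0 tens_sub); apply/zproj_eq; rewrite subr0.
by move=> H; apply.
Qed.

Lemma pureDl x x' y : pure (x + x') y = pure x y + pure x' y.
Proof.
apply/eqP; rewrite -subr_eq0 opprD addrA -!zprojB; apply/eqP/tens_rel0.
by constructor 1; exists x, x', y.
Qed.

Lemma pureDr x y y' : pure x (y + y') = pure x y + pure x y'.
Proof.
apply/eqP; rewrite -subr_eq0 opprD addrA -!zprojB; apply/eqP/tens_rel0.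
by constructor 2; exists x, y, y'.
Qed.

Lemma pureA x a y : pure (ract x a) y = pure x (lact a y).
Proof.
apply/eqP; rewrite -subr_eq0 -zprojB; apply/eqP/tens_rel0.
by constructor 3; exists x, a, y.
Qed.

Lemma pure0l y : pure 0 y = 0.
Proof. by apply: (addrI (pure 0 y)); rewrite -pureDl !addr0. Qed.
Lemma pure0r x : pure x 0 = 0.
Proof. by apply: (addrI (pure x 0)); rewrite -pureDr !addr0. Qed.
Lemma pureNl x y : pure (- x) y = - pure x y.
Proof. by apply: (addrI (pure x y)); rewrite -pureDl !subrr pure0l. Qed.

Lemma tens_ind (H : subgroup tens_car) :
  (forall x y, H (pure x y)) -> forall t, H t.
Proof.
move=> Hp t; rewrite -[t]zreprK -[zrepr t]freeg_sumE.
rewrite (big_morph _ (@zprojD _ tens_sub) (zproj0 _)); apply: sg_sum => -[x y] _.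
have Hn n : H (zproj tens_sub (<< (n%:Z) *g (x, y) >> : F)).
  elim: n => [|n IH]; first by rewrite freegU0 zproj0; apply: sg0.
  by rewrite intS -freegUD zprojD; apply: sgD => //; apply: Hp.
case: (coeff _ _) => n; first exact: Hn.
by rewrite NegzE -freegUN zprojN; apply: sgN; apply: Hn.
Qed.

Definition balanced (G : zmodType) (f : M -> N -> G) : Prop :=
  [/\ forall x x' y, f (x + x') y = f x y + f x' y,
      forall x y y', f x (y + y') = f x y + f x y' &
      forall x a y, f (ract x a) y = f x (lact a y)].

(* The map out of the tensor product induced by [f]; meaningful when [f] is
   balanced. *)
Definition tens_lift (G : zmodType) (f : M -> N -> G) (t : tens_car) : G :=
  fglift (fun p => f p.1 p.2 : zmodule G) (zrepr t).

Section Lift.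
Variables (G : zmodType) (f : M -> N -> G).
Hypothesis fP : balanced f.

Let L : F -> zmodule G := fglift (fun p => f p.1 p.2 : zmodule G).

Let LB x y : L (x - y) = L x - L y. Proof. exact: lift_is_additive. Qed.

Let Lpt x y : L (pt x y) = f x y.
Proof. by rewrite /L liftU scale1r. Qed.

Fact lift_ker0 : L 0 = 0. Proof. by rewrite -(subrr 0) LB subrr. Qed.
Fact lift_kerB x y : L x = 0 -> L y = 0 -> L (x - y) = 0.
Proof. by rewrite LB => -> ->; rewrite subrr. Qed.

Lemma tens_lift_proj u : tens_lift f (zproj tens_sub u) = L u.
Proof.
rewrite /tens_lift -/L; apply/eqP; rewrite -subr_eq0; apply/eqP.
rewrite -[LHS]LB.
apply: (zproj_repr tens_sub u (Subgroup lift_ker0 lift_kerB)) => t.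
have [fDl fDr fA] := fP.
case=> [[x [x' [y ->]]]|[x [y [y' ->]]]|[x [a [y ->]]]] /=; rewrite !LB !Lpt.
- by rewrite fDl addrAC addrK subrr.
- by rewrite fDr addrAC addrK subrr.
- by rewrite fA subrr.
Qed.

Lemma tens_lift_pure x y : tens_lift f (pure x y) = f x y.
Proof. by rewrite tens_lift_proj Lpt. Qed.

Lemma tens_liftD t u : tens_lift f (t + u) = tens_lift f t + tens_lift f u.
Proof.
rewrite -[t]zreprK -[u]zreprK -zprojD !tens_lift_proj.
have L0 v : L (- v) = - L v by rewrite -sub0r LB lift_ker0 sub0r.
by rewrite -{1}[zrepr u]opprK LB L0 opprK.
Qed.

Lemma tens_lift0 : tens_lift f 0 = 0.
Proof. by apply: (addrI (tens_lift f 0)); rewrite -tens_liftD !addr0. Qed.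
Lemma tens_liftN t : tens_lift f (- t) = - tens_lift f t.
Proof. by apply: (addrI (tens_lift f t)); rewrite -tens_liftD !subrr tens_lift0. Qed.
Lemma tens_liftB t u : tens_lift f (t - u) = tens_lift f t - tens_lift f u.
Proof. by rewrite tens_liftD tens_liftN. Qed.

End Lift.

Lemma tens_ext (G : zmodType) (f g : tens_car -> G) :
  {morph f : x y / x + y} -> {morph g : x y / x + y} ->
  (forall x y, f (pure x y) = g (pure x y)) -> forall t, f t = g t.
Proof.
move=> fD gD fg.
have f0 : f 0 = 0 by apply: (addrI (f 0)); rewrite -fD !addr0.
have g0 : g 0 = 0 by apply: (addrI (g 0)); rewrite -gD !addr0.
have fN x : f (- x) = - f x by apply: (addrI (f x)); rewrite -fD !subrr.
have gN x : g (- x) = - g x by apply: (addrI (g x)); rewrite -gD !subrr.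
have eB x y : f x = g x -> f y = g y -> f (x - y) = g (x - y).
  by rewrite fD gD fN gN => -> ->.
have e0 : f 0 = g 0 by rewrite f0 g0.
exact: (@tens_ind (@Subgroup _ (fun t => f t = g t) e0 eB)).
Qed.

Definition tens_lact (b : B) (t : tens_car) : tens_car :=
  tens_lift (fun x y => pure (lact b x) y) t.
Definition tens_ract (t : tens_car) (c : C) : tens_car :=
  tens_lift (fun x y => pure x (ract y c)) t.

Fact tens_lact_bal b : balanced (fun x y => pure (lact b x) y).
Proof.
split=> [x x' y|x y y'|x a y]; first by rewrite lactDr pureDl.
  exact: pureDr.
by rewrite -lractA pureA.
Qed.
Fact tens_ract_bal c : balanced (fun x y => pure x (ract y c)).
Proof.
split=> [x x' y|x y y'|x a y]; first exact: pureDl.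
  by rewrite ractDl pureDr.
by rewrite pureA lractA.
Qed.

Fact tens_lactDr b : {morph tens_lact b : t u / t + u}.
Proof. exact/tens_liftD/tens_lact_bal. Qed.
Fact tens_ractDl c : {morph tens_ract^~ c : t u / t + u}.
Proof. exact/tens_liftD/tens_ract_bal. Qed.
Lemma tens_lact_pure b x y : tens_lact b (pure x y) = pure (lact b x) y.
Proof. exact/tens_lift_pure/tens_lact_bal. Qed.
Lemma tens_ract_pure c x y : tens_ract (pure x y) c = pure x (ract y c).
Proof. exact/(tens_lift_pure (tens_ract_bal c)). Qed.

Definition tens : bimod B C.
Proof.
apply: (@Bimod B C tens_car tens_lact tens_ract).
- move=> b b' t; apply: (tens_ext (f := tens_lact (b + b'))
    (g := fun t => tens_lact b t + tens_lact b' t)); first exact: tens_lactDr.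
    by move=> u v; rewrite !tens_lactDr addrACA.
  by move=> x y; rewrite !tens_lact_pure lactDl pureDl.
- exact: tens_lactDr.
- apply: (tens_ext (f := tens_lact 1) (g := id)) => [||x y] //.
    exact: tens_lactDr.
  by rewrite tens_lact_pure lact1.
- move=> b b'; apply: (tens_ext (f := tens_lact (b * b'))
    (g := fun t => tens_lact b (tens_lact b' t))); first exact: tens_lactDr.
    by move=> u v; rewrite !tens_lactDr.
  by move=> x y; rewrite !tens_lact_pure lactM.
- by move=> t u c; apply: tens_ractDl.
- move=> t c c'; apply: (tens_ext (f := tens_ract^~ (c + c'))
    (g := fun t => tens_ract t c + tens_ract t c')); first exact: tens_ractDl.
    by move=> u v; rewrite !tens_ractDl addrACA.
  by move=> x y; rewrite !tens_ract_pure ractDr pureDr.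
- apply: (tens_ext (f := tens_ract^~ 1) (g := id)) => [||x y] //.
    exact: tens_ractDl.
  by rewrite tens_ract_pure ract1.
- move=> t c c'; apply: (tens_ext (f := tens_ract^~ (c * c'))
    (g := fun t => tens_ract (tens_ract t c) c')); first exact: tens_ractDl.
    by move=> u v; rewrite !tens_ractDl.
  by move=> x y; rewrite !tens_ract_pure ractM.
- move=> b t c; apply: (tens_ext (f := fun t => tens_ract (tens_lact b t) c)
    (g := fun t => tens_lact b (tens_ract t c))).
  + by move=> u v; rewrite tens_lactDr tens_ractDl.
  + by move=> u v; rewrite tens_ractDl tens_lactDr.
  by move=> x y; rewrite tens_lact_pure !tens_ract_pure tens_lact_pure.
Defined.

Lemma lact_pure b x y : @lact _ _ tens b (pure x y) = pure (lact b x) y.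
Proof. exact: tens_lact_pure. Qed.
Lemma ract_pure c x y : @ract _ _ tens (pure x y) c = pure x (ract y c).
Proof. exact: tens_ract_pure. Qed.

End Tensor.

Section TensorPowers.
Variables (D : pzRingType) (M : bimod D D).

(* [tpow n] is [M (x)_D (M (x)_D ... (x)_D (M (x)_D D))] with [n] factors [M]:
   the last factor [D] is absorbed by the canonical isomorphism
   [M (x)_D D = M], and makes the case [n = 0] uniform. *)
Fixpoint tpow (n : nat) : bimod D D :=
  if n is m.+1 then tens M (tpow m) else bimod_reg D.

(* [(x_1 (x) ... (x) x_m (x) d) * u = x_1 (x) ... (x) x_m (x) d u]. *)
Fixpoint tmul (m n : nat) : tpow m -> tpow n -> tpow (m + n) :=
  match m return tpow m -> tpow n -> tpow (m + n) with
  | 0 => fun d u => lact d u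
  | p.+1 => fun t u =>
      @tens_lift _ _ _ M (tpow p) (tpow (p.+1 + n))
        (fun x v => pure x (tmul v u)) t
  end.

Lemma tmul_props m n (u : tpow n) :
  {morph (@tmul m n)^~ u : t t' / t + t'} /\
  (forall d (t : tpow m), tmul (lact d t) u = lact d (tmul t u)).
Proof.
elim: m => [|m [IHD IHA]].
  by split=> [t t'|d t] /=; rewrite ?lactDl ?lactM.
have bal : balanced (fun x v => @pure _ _ _ M (tpow (m + n)) x (tmul v u)).
  split=> [x x' y|x y y'|x a y]; first exact: pureDl.
    by rewrite IHD pureDr.
  by rewrite IHA pureA.
split=> [t t'|d]; first exact: tens_liftD.
apply: (tens_ext (G := tpow (m.+1 + n))
  (f := fun t : tpow m.+1 => @tmul m.+1 n (lact d t) u)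
  (g := fun t : tpow m.+1 => lact d (@tmul m.+1 n t u))).
- by move=> t t'; rewrite lactDr; apply: tens_liftD.
- by move=> t t' /=; rewrite (tens_liftD bal) lactDr.
by move=> x v /=; rewrite lact_pure !(tens_lift_pure bal) lact_pure.
Qed.

Lemma tmulDl m n (t t' : tpow m) (u : tpow n) :
  tmul (t + t') u = tmul t u + tmul t' u.
Proof. by have [->] := tmul_props m u. Qed.

Lemma tmul_lact m n d (t : tpow m) (u : tpow n) :
  tmul (lact d t) u = lact d (tmul t u).
Proof. by have [_ ->] := tmul_props m u. Qed.

Lemma tmul0n n (d : tpow 0) (u : tpow n) : tmul d u = lact d u.
Proof. by []. Qed.

Lemma tmulSn m n x (v : tpow m) (u : tpow n) :
  @tmul m.+1 n (pure x v) u = pure x (tmul v u).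
Proof.
apply: (@tens_lift_pure _ _ _ M (tpow m) (tpow (m.+1 + n))
  (fun x v => @pure _ _ _ M (tpow (m + n)) x (tmul v u))).
split=> [y y' w|y w w'|y a w]; first exact: pureDl.
  by rewrite tmulDl pureDr.
by rewrite tmul_lact pureA.
Qed.

Lemma tpow_ext m (G : zmodType) (f g : tpow m.+1 -> G) :
  {morph f : x y / x + y} -> {morph g : x y / x + y} ->
  (forall x y, f (pure x y) = g (pure x y)) -> forall t, f t = g t.
Proof. exact: tens_ext. Qed.

Lemma tmulDr m n (t : tpow m) (u u' : tpow n) :
  tmul t (u + u') = tmul t u + tmul t u'.
Proof.
elim: m t => [|m IH] t; first exact: lactDr.
move: t; apply: tpow_ext => [t t'|t t'|x v]; rewrite ?tmulDl //.
  by rewrite addrACA.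
by rewrite !tmulSn IH pureDr.
Qed.

Lemma tmul0l m n (u : tpow n) : tmul (0 : tpow m) u = 0.
Proof. by apply: (addrI (tmul 0 u)); rewrite -tmulDl !addr0. Qed.
Lemma tmul0r m n (t : tpow m) : tmul t (0 : tpow n) = 0.
Proof. by apply: (addrI (tmul t 0)); rewrite -tmulDr !addr0. Qed.

Lemma tmul_ract m n (t : tpow m) d (u : tpow n) :
  tmul (ract t d) u = tmul t (lact d u).
Proof.
elim: m t => [|m IH] t; first exact: lactM.
move: t; apply: tpow_ext => [t t'|t t'|x v]; rewrite ?ractDl ?tmulDl //.
have -> : ract (pure x v : tpow m.+1) d = pure x (ract v d) by exact: tens_ract_pure.
by rewrite !tmulSn IH.
Qed.

Local Notation P := (fprod (fun n => tpow n : zmodType)).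

Definition finsupp_set : set P :=
  [set x | exists N, forall n, (N <= n)%N -> x n = 0].

Fact finsupp0 : finsupp_set 0. Proof. by exists 0%N. Qed.
Fact finsuppB x y : finsupp_set x -> finsupp_set y -> finsupp_set (x - y).
Proof.
move=> [N HN] [N' HN']; exists (maxn N N') => n.
rewrite geq_max => /andP[/HN xn /HN' yn].
by rewrite -[LHS]/(x n - y n) xn yn subrr.
Qed.

Definition finsupp : subgroup P := Subgroup finsupp0 finsuppB.

Record talg := Talg { tval : P; tvalP : tval \in sgpred finsupp }.
HB.instance Definition _ := [isSub for tval].
HB.instance Definition _ := [Choice of talg by <:].
HB.instance Definition _ := [SubChoice_isSubZmodule of talg by <:].

Definition tcomp (x : talg) (n : nat) : tpow n := tval x n.
Coercion tcomp : talg >-> Funclass.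
Arguments tcomp : simpl never.

Lemma talgP (x y : talg) : (forall n, x n = y n) -> x = y.
Proof. by move=> xy; apply: val_inj; apply: functional_extensionality_dep. Qed.

Lemma tcompD (x y : talg) n : (x + y) n = x n + y n. Proof. by []. Qed.
Lemma tcompN (x : talg) n : (- x) n = - x n. Proof. by []. Qed.
Lemma tcomp0 n : (0 : talg) n = 0. Proof. by []. Qed.

Lemma tcomp_sum (J : Type) (r : seq J) (Q : pred J) (F : J -> talg) n :
  (\sum_(i <- r | Q i) F i) n = \sum_(i <- r | Q i) F i n.
Proof. exact: (big_morph (fun x : talg => x n) (fun x y => tcompD x y n)). Qed.

Lemma talg_bound (x : talg) :
  exists N, `[< forall n, (N <= n)%N -> x n = 0 >].
Proof. by have /asboolP[N HN] := tvalP x; exists N; apply/asboolP. Qed.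

Definition tbound (x : talg) : nat := ex_minn (talg_bound x).

Lemma tboundP (x : talg) n : (tbound x <= n)%N -> x n = 0.
Proof. by rewrite /tbound; case: ex_minnP => N /asboolP HN _; apply: HN. Qed.

Fact tin_subproof n (u : tpow n) : finsupp_set (finj (V := fun n => tpow n) u).
Proof. by exists n.+1 => j ltnj; apply: finj_out; rewrite ltn_eqF. Qed.

Definition tin n (u : tpow n) : talg :=
  Talg (introT (asboolP _) (tin_subproof u)).
Arguments tin : simpl never.

Lemma tinE n (u : tpow n) : tin u n = u. Proof. exact: finjE. Qed.
Lemma tin_out n (u : tpow n) j : n != j -> tin u j = 0.
Proof. exact: finj_out. Qed.
Lemma tinD n (u v : tpow n) : tin (u + v) = tin u + tin v.
Proof.
apply: talgP => j; rewrite tcompD; have [<-|nj] := eqVneq n j.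
  by rewrite !tinE.
by rewrite !tin_out // addr0.
Qed.
Lemma tin0 n : tin (0 : tpow n) = 0.
Proof. by apply: (addrI (tin (0 : tpow n))); rewrite -tinD !addr0. Qed.

Lemma talg_sum (x : talg) N :
  (forall n, (N <= n)%N -> x n = 0) -> x = \sum_(i < N) tin (x i).
Proof.
move=> HN; apply: talgP => n; rewrite tcomp_sum.
have [ltnN|leNn] := ltnP n N.
  rewrite (bigD1 (Ordinal ltnN)) //= tinE big1 ?addr0 // => i neq.
  by apply: tin_out; apply: contraNneq neq => e; apply/eqP/val_inj.
rewrite HN // big1 // => i _; apply: tin_out.
by rewrite ltn_eqF // (leq_trans (ltn_ord i)).
Qed.

Definition talg_mul (x y : talg) : talg :=
  \sum_(i < tbound x) \sum_(j < tbound y) tin (tmul (x i) (y j)).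

Lemma talg_mulE (x y : talg) N N' :
  (forall n, (N <= n)%N -> x n = 0) -> (forall n, (N' <= n)%N -> y n = 0) ->
  talg_mul x y = \sum_(i < N) \sum_(j < N') tin (tmul (x i) (y j)).
Proof.
move=> HN HN'.
have widen p q (F : nat -> talg) : (p <= q)%N ->
    (forall n, (p <= n)%N -> F n = 0) -> \sum_(i < p) F i = \sum_(i < q) F i.
  move=> lepq F0; rewrite (big_ord_widen _ F lepq) big_mkcond /=.
  by apply: eq_bigr => i _; case: ltnP => // /F0.
have same p q (F : nat -> talg) : (forall n, (p <= n)%N -> F n = 0) ->
    (forall n, (q <= n)%N -> F n = 0) -> \sum_(i < p) F i = \sum_(i < q) F i.
  by case: (leqP p q) => [|/ltnW] l F1 F2; [|symmetry]; apply: widen.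
rewrite /talg_mul.
rewrite (same _ N (fun i => \sum_(j < tbound y) tin (tmul (x i) (y j)))).
- apply: eq_bigr => i _.
  apply: (same _ N' (fun j => tin (tmul (x i) (y j)))) => n le.
    by rewrite (tboundP le) tmul0r tin0.
  by rewrite (HN' _ le) tmul0r tin0.
- by move=> n /tboundP ->; rewrite big1 // => j _; rewrite tmul0l tin0.
- by move=> n /HN ->; rewrite big1 // => j _; rewrite tmul0l tin0.
Qed.

Fact talg_mulDl : left_distributive talg_mul +%R.
Proof.
move=> x y z; set N := maxn (tbound x) (tbound y).
have Hx n : (N <= n)%N -> x n = 0.
  by rewrite geq_max => /andP[le _]; apply: tboundP.
have Hy n : (N <= n)%N -> y n = 0.
  by rewrite geq_max => /andP[_ le]; apply: tboundP.
have Hxy n : (N <= n)%N -> (x + y) n = 0.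
  by move=> le; rewrite tcompD Hx // Hy // addr0.
have Hz := @tboundP z.
rewrite (talg_mulE Hxy Hz) (talg_mulE Hx Hz) (talg_mulE Hy Hz) -big_split.
apply: eq_bigr => i _; rewrite -big_split; apply: eq_bigr => j _ /=.
by rewrite tcompD tmulDl tinD.
Qed.

Fact talg_mulDr : right_distributive talg_mul +%R.
Proof.
move=> z x y; set N := maxn (tbound x) (tbound y).
have Hx n : (N <= n)%N -> x n = 0.
  by rewrite geq_max => /andP[le _]; apply: tboundP.
have Hy n : (N <= n)%N -> y n = 0.
  by rewrite geq_max => /andP[_ le]; apply: tboundP.
have Hxy n : (N <= n)%N -> (x + y) n = 0.
  by move=> le; rewrite tcompD Hx // Hy // addr0.
have Hz := @tboundP z.
rewrite (talg_mulE Hz Hxy) (talg_mulE Hz Hx) (talg_mulE Hz Hy) -big_split.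
apply: eq_bigr => i _; rewrite -big_split; apply: eq_bigr => j _ /=.
by rewrite tcompD tmulDr tinD.
Qed.

Lemma tin_mul m n (u : tpow m) (v : tpow n) :
  talg_mul (tin u) (tin v) = tin (tmul u v).
Proof.
have Hb p (w : tpow p) j : (p.+1 <= j)%N -> tin w j = 0.
  by move=> lt; apply: tin_out; rewrite ltn_eqF.
rewrite (talg_mulE (Hb _ u) (Hb _ v)) (bigD1 ord_max) //= (bigD1 ord_max) //=.
rewrite !tinE !big1 ?addr0 // => i ni.
  rewrite big1 // => j _; rewrite (@tin_out m) ?tmul0l ?tin0 //.
  by apply: contraNneq ni => e; apply/eqP/val_inj.
by rewrite (@tin_out n) ?tmul0r ?tin0 //; apply: contraNneq ni => e; apply/eqP/val_inj.
Qed.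

Lemma talg_mul0 x : talg_mul 0 x = 0.
Proof. by apply: (addrI (talg_mul 0 x)); rewrite -talg_mulDl !addr0. Qed.
Lemma talg_mulr0 x : talg_mul x 0 = 0.
Proof. by apply: (addrI (talg_mul x 0)); rewrite -talg_mulDr !addr0. Qed.

Lemma talg_ind (Q : talg -> Prop) :
  Q 0 -> (forall x y, Q x -> Q y -> Q (x + y)) ->
  (forall n (u : tpow n), Q (tin u)) -> forall x, Q x.
Proof.
move=> Q0 QD Qin x; rewrite (talg_sum (@tboundP x)).
by apply: (big_ind Q) => // i _; apply: Qin.
Qed.

(* Left multiplication by a vector of [M], used to compare elements whose
   degrees are equal but not convertible. *)
Definition tshift (x : M) (y : talg) : P :=
  fun n => if n is m.+1 then pure x (y m) else 0.

Lemma tshift_tin x n (u : tpow n) :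
  tshift x (tin u) = tval (tin (pure x u : tpow n.+1)).
Proof.
apply: functional_extensionality_dep => j.
rewrite -[RHS]/(tin (pure x u : tpow n.+1) j).
case: j => [|j] /=; first by rewrite tin_out.
have [<-|nj] := eqVneq n j; first by rewrite !tinE.
by rewrite !tin_out // pure0r.
Qed.

Lemma tin_shift x m n (u : tpow m) (v : tpow n) : tin u = tin v ->
  tin (pure x u : tpow m.+1) = tin (pure x v : tpow n.+1).
Proof. by move=> e; apply: val_inj; rewrite -[LHS]tshift_tin e tshift_tin. Qed.

Lemma tin_tmulA m n p (u : tpow m) (v : tpow n) (w : tpow p) :
  tin (tmul u (tmul v w)) = tin (tmul (tmul u v) w).
Proof.
elim: m u => [|m IH] u; first by rewrite !tmul0n tmul_lact.
move: u; apply: tpow_ext => [t t'|t t'|x u]; rewrite ?tmulDl ?(@tmulDl (m.+1 + n)) ?tinD //.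
rewrite !tmulSn; apply: tin_shift; exact: IH.
Qed.

Lemma tin_tmulr1 m (u : tpow m) : tin (tmul u (1 : tpow 0)) = tin u.
Proof.
elim: m u => [|m IH] u; first by congr tin; apply: mulr1.
move: u; apply: tpow_ext => [t t'|t t'|x u]; rewrite ?tmulDl ?(@tmulDl (m.+1 + n)) ?tinD //.
by rewrite tmulSn; apply: tin_shift; apply: IH.
Qed.

Fact talg_mulA : associative talg_mul.
Proof.
move=> x y z; elim/talg_ind: x => [|x x' IH IH'|m u].
- by rewrite !talg_mul0.
- by rewrite !talg_mulDl IH IH'.
elim/talg_ind: y => [|y y' IH IH'|n v].
- by rewrite talg_mulr0 !talg_mul0 talg_mulr0.
- by rewrite talg_mulDr !talg_mulDl talg_mulDr IH IH'.
elim/talg_ind: z => [|z z' IH IH'|p w].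
- by rewrite !talg_mulr0.
- by rewrite !talg_mulDr IH IH'.
by rewrite !tin_mul tin_tmulA.
Qed.

Definition talg1 : talg := tin (1 : tpow 0).

Fact talg_mul1 : left_id talg1 talg_mul.
Proof.
elim/talg_ind => [|x x' IH IH'|m u]; first exact: talg_mulr0.
  by rewrite talg_mulDr IH IH'.
by rewrite tin_mul; congr tin; apply: lact1.
Qed.

Fact talg_mulr1 : right_id talg1 talg_mul.
Proof.
elim/talg_ind => [|x x' IH IH'|m u]; first exact: talg_mul0.
  by rewrite talg_mulDl IH IH'.
by rewrite tin_mul tin_tmulr1.
Qed.

HB.instance Definition _ := GRing.Zmodule_isPzRing.Build talg
  talg_mulA talg_mul1 talg_mulr1 talg_mulDl talg_mulDr.

Lemma tinM m n (u : tpow m) (v : tpow n) : tin u * tin v = tin (tmul u v).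
Proof. exact: tin_mul. Qed.

(* [x] in [M^(1)], written [x (x) 1] because of the convention on [tpow]. *)
Definition tgen (x : M) : talg := tin (@pure _ _ _ M (tpow 0) x (1 : D) : tpow 1).

Definition tplus : set talg := [set x | x 0%N = 0].

End TensorPowers.


Arguments tplus {D} M.

(* [k] acts on the left through [B]; in a species it acts in the same way on
   the right. *)
Definition fin_dim (k : fieldType) (B A : algType k) (M : bimod B A) : Prop :=
  exists s : seq M, forall m : M, exists c : nat -> k,
    m = \sum_(l < size s) lact (c l)%:A s`_l.

(* [sM j i] is the [sD j]-[sD i]-bimodule of arrows from [i] to [j]. *)
Record species (k : fieldType) := Species {
  sI : finType;
  sI_inh : inhabited sI;
  sD : sI -> falgType k;
  sD_div : forall i (d : sD i), d != 0 -> d \is a GRing.unit;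
  sM : forall j i, bimod (sD j) (sD i);
  sM_central : forall j i (c : k) (m : sM j i), lact c%:A m = ract m c%:A;
  sM_fin : forall j i, fin_dim (sM j i) }.
Arguments sI {k} s.
Arguments sI_inh {k} s.
Arguments sD {k} s i.
Arguments sM {k} s j i.

Section SpeciesTensorAlgebra.
Variables (k : fieldType) (S : species k).

Definition sring := fprod (fun i => sD S i).
HB.instance Definition _ := GRing.PzRing.on sring.
HB.instance Definition _ := GRing.Lmodule.on sring.

Local Notation MM :=
  (fprod (fun p : sI S * sI S => sM S p.1 p.2 : zmodType)).

(* The direct sum of all [sM S j i]; an element is a family indexed by the
   pairs [p = (j, i)], so [p.1] is the target and [p.2] the source. *)
Definition sbimod : bimod sring sring.
Proof.
apply: (@Bimod sring sring MM (fun (d : sring) (x : MM) p => lact (d p.1) (x p))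
  (fun (x : MM) (d : sring) p => ract (x p) (d p.2)));
  intros; apply: functional_extensionality_dep => p.
- exact: lactDl.
- exact: lactDr.
- exact: lact1.
- exact: lactM.
- exact: ractDl.
- exact: ractDr.
- exact: ract1.
- exact: ractM.
- exact: lractA.
Defined.

Definition tensor_algebra : Type := talg sbimod.
HB.instance Definition _ := GRing.PzRing.on tensor_algebra.

End SpeciesTensorAlgebra.
Section SpeciesTensorAlgebraTheory.
Variables (k : fieldType) (S : species k).
Local Notation D := (sring S).
Local Notation M := (sbimod S).
Local Notation T := (tensor_algebra S).

Lemma sbimod_central (c : k) (x : M) : lact (c *: (1 : D) : D) x = ract x (c *: (1 : D) : D).
Proof. by apply: functional_extensionality_dep => p; apply: sM_central. Qed.

Lemma sringZl (c : k) (d : D) : (c *: (1 : D) : D) * d = c *: d.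
Proof.
by apply: functional_extensionality_dep => i; exact: (mulr_algl c (d i)).
Qed.
Lemma sringZr (c : k) (d : D) : d * (c *: (1 : D) : D) = c *: d.
Proof.
by apply: functional_extensionality_dep => i; exact: (mulr_algr c (d i)).
Qed.

Lemma tpow_central n (c : k) (u : tpow M n) :
  lact (c *: (1 : D) : D) u = ract u (c *: (1 : D) : D).
Proof.
elim: n u => [|n IH] u; first exact: etrans (sringZl c u) (esym (sringZr c u)).
move: u; apply: tpow_ext => [t t'|t t'|x v].
- exact: lactDr.
- exact: ractDl.
by rewrite lact_pure ract_pure sbimod_central pureA IH.
Qed.

Fact talg_1_neq0 : (1 : T) != 0.
Proof.
apply/eqP => e; have [i] := sI_inh S.
have : (1 : T) 0%N = (0 : T) 0%N by rewrite e.
rewrite -[LHS]/(tin (1 : tpow M 0) 0%N) tinE => /(congr1 (fun d : D => d i)).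
by move=> /eqP; rewrite -[_ == _]/(1 == 0 :> sD S i) oner_eq0.
Qed.
HB.instance Definition _ := GRing.PzSemiRing_isNonZero.Build T talg_1_neq0.

Definition talg_scale (c : k) (x : T) : T := tin (c *: (1 : D) : tpow M 0) * x.

Fact talg_scaleA a b v : talg_scale a (talg_scale b v) = talg_scale (a * b) v.
Proof.
rewrite /talg_scale mulrA tinM; congr (tin _ * _).
by rewrite -[LHS]/((a *: (1 : D) : D) * (b *: (1 : D) : D)) sringZl scalerA.
Qed.
Fact talg_scale1 : left_id 1 talg_scale.
Proof. by move=> v; rewrite /talg_scale scale1r; apply: mul1r. Qed.
Fact talg_scaleDr : right_distributive talg_scale +%R.
Proof. by move=> a u v; apply: mulrDr. Qed.
Fact talg_scaleDl v : {morph talg_scale^~ v : a b / a + b}.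
Proof.
by move=> a b; rewrite /talg_scale -mulrDl -tinD -[in RHS]scalerDl.
Qed.
HB.instance Definition _ := GRing.Zmodule_isLmodule.Build k T
  talg_scaleA talg_scale1 talg_scaleDr talg_scaleDl.

Fact talg_scaleAl (c : k) (x y : T) : c *: (x * y) = (c *: x) * y.
Proof. exact: mulrA. Qed.
HB.instance Definition _ :=
  GRing.LSemiModule_isLSemiAlgebra.Build k T talg_scaleAl.

Fact talg_scaleAr (c : k) (x y : T) : c *: (x * y) = x * (c *: y).
Proof.
suff comm z : tin (c *: (1 : D) : tpow M 0) * z = z * tin (c *: (1 : D) : tpow M 0) :> T.
  rewrite -[LHS]/(tin (c *: (1 : D) : tpow M 0) * (x * y)).
  by rewrite mulrA comm -mulrA.
elim/talg_ind: z => [|z z' IH IH'|n u]; first by rewrite mul0r mulr0.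
  by rewrite mulrDl mulrDr IH IH'.
rewrite !tinM tmul0n tpow_central -tin_tmulr1 tmul_ract.
by congr (tin (tmul _ _)); apply: mulr1.
Qed.
HB.instance Definition _ :=
  GRing.LSemiAlgebra_isSemiAlgebra.Build k T talg_scaleAr.

(* The ideal [M^(1) + M^(2) + ...]. *)
Definition tideal : set T := tplus M.

(* There is an arrow from [i] to [j] in the quiver of [S]. *)
Definition arrow (i j : sI S) : Prop := exists m : sM S j i, m != 0.

Definition sgen (j i : sI S) (m : sM S j i) : T :=
  tgen (finj (V := fun p : sI S * sI S => sM S p.1 p.2) (i := (j, i)) m : M).

(* [path_tensor a b g] says that [g = g_n (x) ... (x) g_1], [n >= 1], is an
   elementary tensor along a path from [a] to [b]; the last arrow is on the
   left, and the tensor product is the multiplication of [T]. *)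
Inductive path_tensor (a : sI S) : sI S -> T -> Prop :=
| PathTensor1 b (m : sM S b a) : arrow a b -> path_tensor a b (sgen m)
| PathTensorS b c (m : sM S c b) (g : T) :
    arrow b c -> path_tensor a b g -> path_tensor a c (sgen m * g).

Definition relation_from_to (a b : sI S) (sigma : T) : Prop :=
  exists n (g : 'I_n.+1 -> T),
    (forall l, path_tensor a b (g l)) /\ sigma = \sum_l g l.

Definition is_relation (sigma : T) : Prop :=
  exists a b, relation_from_to a b sigma.

Definition set_of_relations (rho : set T) : Prop :=
  forall sigma, rho sigma -> is_relation sigma.

End SpeciesTensorAlgebraTheory.

Arguments tideal {k} S.

Section Conormal.
Variables (R : pzRingType) (I : ideal R).

Fact conormal0 : iprod I I (sgval (0 : sgtype I)).
Proof. exact: iprod0. Qed.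
Fact conormalB (x y : sgtype I) : iprod I I (sgval x) -> iprod I I (sgval y) ->
  iprod I I (sgval (x - y)).
Proof. exact: iprod_subgroup. Qed.

Definition square : subgroup (sgtype I) :=
  @Subgroup (sgtype I) (fun x => iprod I I (sgval x)) conormal0 conormalB.

Definition conormal_car := zquot square.
HB.instance Definition _ := GRing.Zmodule.on conormal_car.

Definition idMl (a : R) (x : sgtype I) : sgtype I :=
  to_sg (idealMl a (sgtypeP x)).
Definition idMr (x : sgtype I) (a : R) : sgtype I :=
  to_sg (idealMr a (sgtypeP x)).

Definition conormal_lact (a : rquot I) (m : conormal_car) : conormal_car :=
  zproj square (idMl (zrepr a) (zrepr m)).
Definition conormal_ract (m : conormal_car) (a : rquot I) : conormal_car :=
  zproj square (idMr (zrepr m) (zrepr a)).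

Lemma iprodD (x y : R) : iprod I I x -> iprod I I y -> iprod I I (x + y).
Proof.
move=> Hx Hy; rewrite -[y]opprK -[- y]sub0r; apply: iprod_subgroup => //.
by apply: iprod_subgroup => //; apply: iprod0.
Qed.

Lemma iprodMl a x : iprod I I x -> iprod I I (a * x).
Proof.
move=> [n [y [z [H ->]]]]; exists n, (fun l => a * y l), z; split.
  by move=> l; have [Hy Hz] := H l; split=> //; apply: idealMl.
by rewrite mulr_sumr; apply: eq_bigr => l _; rewrite mulrA.
Qed.
Lemma iprodMr x a : iprod I I x -> iprod I I (x * a).
Proof.
move=> [n [y [z [H ->]]]]; exists n, y, (fun l => z l * a); split.
  by move=> l; have [Hy Hz] := H l; split=> //; apply: idealMr.
by rewrite mulr_suml; apply: eq_bigr => l _; rewrite mulrA.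
Qed.

Lemma conormal_lactE a x :
  conormal_lact (rproj I a) (zproj square x) = zproj square (idMl a x).
Proof.
apply/zproj_eq; rewrite /= .
set b := zrepr _; set y := zrepr _.
have -> : b * sgval y - a * sgval x = (b - a) * sgval y + a * sgval (y - x).
  by rewrite mulrBl mulrBr addrA subrK.
apply: iprodD.
  by apply: iprod_incl; [exact: zproj_repr|exact: sgtypeP].
by apply: iprodMl; apply: (zproj_repr square).
Qed.

Lemma conormal_ractE x a :
  conormal_ract (zproj square x) (rproj I a) = zproj square (idMr x a).
Proof.
apply/zproj_eq; rewrite /= .
set b := zrepr _; set y := zrepr (zproj _ a).
have -> : sgval b * y - sgval x * a = sgval b * (y - a) + sgval (b - x) * a.
  by rewrite mulrBl mulrBr addrA subrK.
apply: iprodD.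
  by apply: iprod_incl; [exact: sgtypeP|exact: zproj_repr].
by apply: iprodMr; apply: (zproj_repr square).
Qed.

Definition conormal : bimod (rquot I) (rquot I).
Proof.
apply: (@Bimod _ _ conormal_car conormal_lact conormal_ract).
- move=> b b' x; rewrite -[b]rprojK -[b']rprojK -[x]zreprK -rprojD.
  rewrite !conormal_lactE -zprojD; congr zproj; apply: val_inj; exact: mulrDl.
- move=> b x y; rewrite -[b]rprojK -[x]zreprK -[y]zreprK -zprojD.
  rewrite !conormal_lactE -zprojD; congr zproj; apply: val_inj; exact: mulrDr.
- move=> x; rewrite -[x]zreprK -[1]/(rproj I 1) conormal_lactE.
  congr zproj; apply: val_inj; exact: mul1r.
- move=> b b' x; rewrite -[b]rprojK -[b']rprojK -[x]zreprK -rprojM.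
  rewrite !conormal_lactE; congr zproj; apply: val_inj; exact/esym/mulrA.
- move=> x y a; rewrite -[a]rprojK -[x]zreprK -[y]zreprK -zprojD.
  rewrite !conormal_ractE -zprojD; congr zproj; apply: val_inj; exact: mulrDl.
- move=> x a a'; rewrite -[a]rprojK -[a']rprojK -[x]zreprK -rprojD.
  rewrite !conormal_ractE -zprojD; congr zproj; apply: val_inj; exact: mulrDr.
- move=> x; rewrite -[x]zreprK -[1]/(rproj I 1) conormal_ractE.
  congr zproj; apply: val_inj; exact: mulr1.
- move=> x a a'; rewrite -[a]rprojK -[a']rprojK -[x]zreprK -rprojM.
  rewrite !conormal_ractE; congr zproj; apply: val_inj; exact: mulrA.
- move=> b x a; rewrite -[b]rprojK -[a]rprojK -[x]zreprK.
  rewrite conormal_lactE !conormal_ractE conormal_lactE.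
  congr zproj; apply: val_inj; exact/esym/mulrA.
Defined.

End Conormal.

Section AlgebraBimodules.
Variables (k : fieldType) (A : algType k).

(* [A] as an [A]-[k]-bimodule and as a [k]-[A]-bimodule. *)
Definition alg_left : bimod A k.
Proof.
apply: (@Bimod A k A *%R (fun x c => c *: x)).
- exact: mulrDl.
- exact: mulrDr.
- exact: mul1r.
- by move=> b b' x; rewrite mulrA.
- by move=> x y a; rewrite scalerDr.
- by move=> x a a'; rewrite scalerDl.
- exact: scale1r.
- by move=> x a a'; rewrite scalerA mulrC.
- by move=> b x a; rewrite scalerAr.
Defined.

Definition alg_right : bimod k A.
Proof.
apply: (@Bimod k A A *:%R *%R).
- by move=> b b' x; rewrite scalerDl.
- exact: scalerDr.
- exact: scale1r.
- by move=> b b' x; rewrite scalerA.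
- exact: mulrDl.
- exact: mulrDr.
- exact: mulr1.
- exact: mulrA.
- by move=> b x a; rewrite scalerAl.
Defined.

End AlgebraBimodules.

Section FiniteDimension.
Variable k : fieldType.

Lemma fin_dim_gen (B A : algType k) (M : bimod B A) (s : seq M) :
  (forall H : subgroup M, (forall c m, H m -> H (lact (c%:A) m)) ->
     (forall m, m \in s -> H m) -> forall m, H m) -> fin_dim M.
Proof.
move=> Hs; exists s.
pose Q m := exists c : nat -> k, m = \sum_(l < size s) lact (c l)%:A s`_l.
have Q0 : Q 0.
  by exists (fun=> 0); rewrite big1 // => l _; rewrite scale0r lact0l.
have QB x y : Q x -> Q y -> Q (x - y).
  move=> [c ->] [d ->]; exists (fun l => c l - d l).
  rewrite -sumrB; apply: eq_bigr => l _.
  by rewrite scalerBl lactDl lactNl.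
apply: (Hs (Subgroup Q0 QB)) => /= [c m [d ->]|m /(nthP 0)[l ltl <-]].
  exists (fun l => c * d l); rewrite lact_sum; apply: eq_bigr => l _.
  by rewrite -lactM -scalerAl mul1r scalerA.
exists (fun l' => (l' == l)%:R); rewrite (bigD1 (Ordinal ltl)) //= eqxx scale1r lact1.
rewrite big1 ?addr0 // => l' ne; rewrite -val_eqE /= in ne.
by rewrite (negPf ne) scale0r lact0l.
Qed.

Lemma fin_dim_span (B A : algType k) (M : bimod B A) : fin_dim M ->
  exists s : seq M, forall H : subgroup M, (forall c m, H m -> H (lact (c%:A) m)) ->
     (forall m, m \in s -> H m) -> forall m, H m.
Proof.
move=> [s Hs]; exists s => H HZ Hin m; have [c ->] := Hs m.
by apply: sg_sum => l _; apply/HZ/Hin/mem_nth.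
Qed.

Lemma subspace_vspace (V : vectType k) (H : subgroup V) :
  (forall c x, H x -> H (c *: x)) ->
  exists U : {vspace V}, forall x, x \in U <-> H x.
Proof.
move=> HZ; pose Q n := `[< exists U : {vspace V},
  \dim U = n /\ forall x, x \in U -> H x >].
have Q0 : exists n, Q n.
  exists 0%N; apply/asboolP; exists 0%VS; split; first exact: dimv0.
  by move=> x; rewrite memv0 => /eqP ->; apply: sg0.
have Qm n : Q n -> (n <= \dim (@fullv k V))%N.
  by move=> /asboolP[U [<- _]]; apply/dimvS/subvf.
have [n /asboolP[U [dU HU]] maxn] := ex_maxnP Q0 Qm.
exists U => x; split; first exact: HU.
move=> Hx; apply: contraT => nUx.
have /maxn : Q (\dim (U + <[x]>)%VS).
  apply/asboolP; exists (U + <[x]>)%VS; split=> // z /memv_addP[u Uu [v]].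
  move=> /vlineP[c ->] ->; by apply: sgD; [apply: HU|apply: HZ].
rewrite -dU => le.
have /eqP e : U == (U + <[x]>)%VS by rewrite eqEdim addvSl.
by move: nUx; rewrite e (subvP (addvSr U _)) // memv_line.
Qed.

End FiniteDimension.

(* [B (x)_k N (x)_k A] for a [k]-[k]-bimodule [N]. *)
Section Sandwich.
Variables (k : fieldType) (B A : falgType k) (N : bimod k k).

Definition sandwich : bimod B A := tens (tens (alg_left B) N) (alg_right A).

Definition pure3 (x : B) (n : N) (y : A) : sandwich :=
  @pure _ _ _ (tens (alg_left B) N) (alg_right A)
    (@pure _ _ _ (alg_left B) N x n) y.

Lemma pure3Dl x x' n y : pure3 (x + x') n y = pure3 x n y + pure3 x' n y.
Proof. by rewrite /pure3 !pureDl. Qed.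
Lemma pure3Dm x n n' y : pure3 x (n + n') y = pure3 x n y + pure3 x n' y.
Proof. by rewrite /pure3 pureDr pureDl. Qed.
Lemma pure3Dr x n y y' : pure3 x n (y + y') = pure3 x n y + pure3 x n y'.
Proof. exact: pureDr. Qed.
Lemma pure3_0l n y : pure3 0 n y = 0.
Proof. by apply: (addrI (pure3 0 n y)); rewrite -pure3Dl !addr0. Qed.
Lemma pure3_0m x y : pure3 x 0 y = 0.
Proof. by apply: (addrI (pure3 x 0 y)); rewrite -pure3Dm !addr0. Qed.
Lemma pure3_0r x n : pure3 x n 0 = 0.
Proof. by apply: (addrI (pure3 x n 0)); rewrite -pure3Dr !addr0. Qed.
Lemma pure3Nm x n y : pure3 x (- n) y = - pure3 x n y.
Proof. by apply: (addrI (pure3 x n y)); rewrite -pure3Dm !subrr pure3_0m. Qed.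

Lemma pure3Zl c x n y : pure3 (c *: x) n y = pure3 x (lact c n) y.
Proof. by congr pure; exact: (@pureA _ _ _ (alg_left B) N). Qed.
Lemma pure3Zr c x n y : pure3 x n (c *: y) = pure3 x (ract n c) y.
Proof.
have -> : pure3 x n (c *: y) =
    @pure _ _ _ (tens (alg_left B) N) (alg_right A)
      (ract (@pure _ _ _ (alg_left B) N x n : tens (alg_left B) N) c) y.
  exact/esym/(@pureA _ _ _ (tens (alg_left B) N) (alg_right A)).
by rewrite ract_pure.
Qed.
Lemma lact_pure3 b x n y : lact b (pure3 x n y) = pure3 (b * x) n y.
Proof. by rewrite [LHS]lact_pure [X in pure X _ = _]lact_pure. Qed.
Lemma ract_pure3 x n y a : ract (pure3 x n y) a = pure3 x n (y * a).
Proof. by rewrite [LHS]ract_pure. Qed.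

Lemma sandwich_ind (H : subgroup sandwich) :
  (forall x n y, H (pure3 x n y)) -> forall t, H t.
Proof.
move=> Hp; apply: tens_ind => u y.
pose p (u : tens (alg_left B) N) : sandwich :=
  @pure _ _ _ (tens (alg_left B) N) (alg_right A) u y.
have K0 : H (p 0) by rewrite /p pure0l; apply: sg0.
have KB a b : H (p a) -> H (p b) -> H (p (a - b)).
  by move=> Ha Hb; rewrite /p pureDl pureNl; apply: sgB.
apply: (@tens_ind _ _ _ _ _ (@Subgroup _ (fun u => H (p u)) K0 KB)) => x n.
exact: Hp.
Qed.

Hypothesis N_central : forall (c : k) (n : N), lact c n = ract n c.

Lemma sandwich_central (c : k) (t : sandwich) : lact c%:A t = ract t c%:A.
Proof.
have K0 : lact c%:A (0 : sandwich) = ract (0 : sandwich) c%:A.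
  by rewrite lact0 ract0.
have KB (a b : sandwich) : lact c%:A a = ract a c%:A ->
    lact c%:A b = ract b c%:A -> lact c%:A (a - b) = ract (a - b) c%:A.
  by move=> ea eb; rewrite lactDr lactN ea eb ractDl ractN.
apply: (sandwich_ind (H := @Subgroup sandwich
  (fun t => lact c%:A t = ract t c%:A) K0 KB)) => x n y /=.
by rewrite lact_pure3 ract_pure3 mulr_algl mulr_algr pure3Zl pure3Zr N_central.
Qed.

Lemma sandwich_fin (s : seq N) :
  (forall H : subgroup N, (forall c n, H n -> H (lact c n)) ->
     (forall n, n \in s -> H n) -> forall n, H n) ->
  fin_dim sandwich.
Proof.
move=> Hs.
pose X := vbasis (@fullv _ B); pose Y := vbasis (@fullv _ A).
have ppx c x m y : pure3 (c *: x) m y = lact c%:A (pure3 x m y).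
  by rewrite lact_pure3 mulr_algl.
have ppm c x m y : pure3 x (lact c m) y = lact c%:A (pure3 x m y).
  by rewrite -ppx pure3Zl.
have ppy c x m y : pure3 x m (c *: y) = lact c%:A (pure3 x m y).
  by rewrite pure3Zr -N_central ppm.
apply: (@fin_dim_gen _ _ _ _
  (flatten [seq [seq pure3 x m y | m <- s] | x <- X, y <- Y])) => H HC Hin.
have H3 x m y : x \in X -> m \in s -> y \in Y -> H (pure3 x m y).
  move=> xX ms yY; apply: Hin; apply/flattenP.
  exists [seq pure3 x m y | m <- s]; last exact: map_f.
  by apply/allpairsP; exists (x, y).
have H2 x m y : x \in X -> m \in s -> H (pure3 x m y).
  move=> xX ms; rewrite (coord_vbasis (memvf y)).
  rewrite (big_morph (pure3 x m) (pure3Dr x m) (pure3_0r x m)).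
  apply: sg_sum => l _; rewrite ppy; apply: HC; apply: H3 => //.
  by apply: mem_nth; rewrite size_tuple.
have H1 x m y : m \in s -> H (pure3 x m y).
  move=> ms; rewrite (coord_vbasis (memvf x)).
  rewrite (big_morph (fun x => pure3 x m y) (fun a b => pure3Dl a b m y)
    (pure3_0l m y)).
  apply: sg_sum => l _; rewrite ppx; apply: HC; apply: H2 => //.
  by apply: mem_nth; rewrite size_tuple.
apply: sandwich_ind => x m y.
have K0 : H (pure3 x 0 y) by rewrite pure3_0m; apply: sg0.
have KB a b : H (pure3 x a y) -> H (pure3 x b y) -> H (pure3 x (a - b) y).
  by move=> Ha Hb; rewrite pure3Dm pure3Nm; apply: sgB.
apply: (Hs (@Subgroup _ (fun m => H (pure3 x m y)) K0 KB)) => [c a Ha|a /H1] //=.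
by rewrite ppm; apply: HC.
Qed.

End Sandwich.

Section Corner.
Variables (k : fieldType) (I : finType) (D : I -> falgType k) (R : pzRingType).
Local Notation P := (fprod (fun i => D i)).
Variables (psi : {rmorphism P -> R}) (X : bimod R R).

(* [D i] seen inside [R]. *)
Definition cin (i : I) (d : D i) : R := psi (finj (V := fun i => D i) d).

Lemma finjM i (d d' : D i) :
  finj (V := fun i => D i) (d * d') =
  (finj (V := fun i => D i) d : P) * (finj (V := fun i => D i) d' : P).
Proof.
apply: functional_extensionality_dep => l.
rewrite -[RHS]/(finj (V := fun i => D i) d l * finj (V := fun i => D i) d' l).
have [<-|ne] := eqVneq i l; first by rewrite !finjE.
by rewrite !finj_out // mul0r.
Qed.
Lemma finjD i (d d' : D i) :
  finj (V := fun i => D i) (d + d') =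
  (finj (V := fun i => D i) d : P) + (finj (V := fun i => D i) d' : P).
Proof.
apply: functional_extensionality_dep => l.
rewrite -[RHS]/(finj (V := fun i => D i) d l + finj (V := fun i => D i) d' l).
have [<-|ne] := eqVneq i l; first by rewrite !finjE.
by rewrite !finj_out // addr0.
Qed.
Lemma finjZ i c (d : D i) :
  finj (V := fun i => D i) (c *: d) = c *: (finj (V := fun i => D i) d : P).
Proof.
apply: functional_extensionality_dep => l.
rewrite -[RHS]/(c *: finj (V := fun i => D i) d l).
have [<-|ne] := eqVneq i l; first by rewrite !finjE.
by rewrite !finj_out // scaler0.
Qed.

Lemma cinM i (d d' : D i) : cin (d * d') = cin d * cin d'.
Proof. by rewrite /cin finjM rmorphM. Qed.
Lemma cinD i (d d' : D i) : cin (d + d') = cin d + cin d'.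
Proof. by rewrite /cin finjD rmorphD. Qed.

Variables j i : I.

(* [D_j X D_i]. *)
Definition corner_set : set X :=
  [set m | exists n (d : 'I_n -> D j) (x : 'I_n -> X) (d' : 'I_n -> D i),
     m = \sum_l ract (lact (cin (d l)) (x l)) (cin (d' l))].

Lemma cornerP m :
  corner_set m <-> m = ract (lact (cin (1 : D j)) m) (cin (1 : D i)).
Proof.
split=> [[n [d [x [d' ->]]]]|e]; last first.
  by exists 1%N, (fun=> 1), (fun=> m), (fun=> 1); rewrite big_ord1.
rewrite lact_sum ract_sum; apply: eq_bigr => l _.
by rewrite -lractA -lactM -cinM mul1r -ractM -cinM mulr1.
Qed.

Fact corner0 : corner_set 0.
Proof. by apply/cornerP; rewrite lact0 ract0. Qed.
Fact cornerB x y : corner_set x -> corner_set y -> corner_set (x - y).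
Proof.
move=> /cornerP ex /cornerP ey; apply/cornerP.
by rewrite lactDr lactN ractDl ractN -ex -ey.
Qed.
Definition corner_sg : subgroup X :=
  @Subgroup X corner_set corner0 cornerB.

Fact corner_lact_subproof d m : corner_set m -> corner_set (lact (cin (d : D j)) m).
Proof.
move=> /cornerP e; apply/cornerP.
by rewrite -lactM -cinM mul1r lractA {1}e lractA -lactM -cinM mulr1.
Qed.
Fact corner_ract_subproof d m : corner_set m -> corner_set (ract m (cin (d : D i))).
Proof.
move=> /cornerP e; apply/cornerP.
by rewrite -lractA -ractM -cinM mulr1 {1}e -ractM -cinM mul1r.
Qed.

Lemma corner1l m : corner_set m -> lact (cin (1 : D j)) m = m.
Proof.
by move=> /cornerP e; rewrite e -lractA -lactM -cinM mulr1.
Qed.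
Lemma corner1r m : corner_set m -> ract m (cin (1 : D i)) = m.
Proof.
by move=> /cornerP e; rewrite e -ractM -cinM mulr1.
Qed.

Local Notation C := (sgtype corner_sg).

Definition corner_lact (d : D j) (m : C) : C :=
  to_sg (H := corner_sg) (corner_lact_subproof d (sgtypeP m)).
Definition corner_ract (m : C) (d : D i) : C :=
  to_sg (H := corner_sg) (corner_ract_subproof d (sgtypeP m)).

Definition corner : bimod (D j) (D i).
Proof.
apply: (@Bimod (D j) (D i) C corner_lact corner_ract).
- by move=> b b' x; apply: val_inj; rewrite /= cinD lactDl.
- by move=> b x y; apply: val_inj; rewrite /= lactDr.
- by move=> x; apply: val_inj; rewrite /= corner1l //; exact: (sgtypeP x).
- by move=> b b' x; apply: val_inj; rewrite /= cinM lactM.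
- by move=> x y a; apply: val_inj; rewrite /= ractDl.
- by move=> x a a'; apply: val_inj; rewrite /= cinD ractDr.
- by move=> x; apply: val_inj; rewrite /= corner1r //; exact: (sgtypeP x).
- by move=> x a a'; apply: val_inj; rewrite /= cinM ractM.
- by move=> b x a; apply: val_inj; rewrite /= lractA.
Defined.

End Corner.

(* A [k]-algebra isomorphism from a finite direct sum of division algebras onto
   [A / rad A].  It exists when [A] is basic, and it fixes the identification
   of each [wD i] with an ideal of [A / rad A] used in the enlarged species. *)
Record wedderburn (k : fieldType) (A : falgType k) := Wedderburn {
  wI : finType;
  wI_inh : inhabited wI;
  wD : wI -> falgType k;
  wD_div : forall i (d : wD i), d != 0 -> d \is a GRing.unit;
  wpsi : {rmorphism fprod (fun i => wD i) -> rquot (rad A)};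
  wpsi_scalable : forall (c : k) x, wpsi (c *: x) = c *: wpsi x;
  wpsi_bij : bijective wpsi }.

Section Enlarged.
Variables (k : fieldType) (A : falgType k) (W : wedderburn A).

(* [D_j (r / r^2) D_i]. *)
Definition gabriel_bimod (j i : wI W) : bimod (wD j) (wD i) :=
  corner (wpsi W) (conormal (rad A)) j i.

(* [D_j (x)_k D_j (r / r^2) D_i (x)_k D_i]. *)
Definition enlarged_M (j i : wI W) : bimod (wD j) (wD i) :=
  sandwich (wD j) (wD i)
    (bimod_res (in_alg (wD j)) (in_alg (wD i)) (gabriel_bimod j i)).

Lemma cinZ i c (d : wD i) : cin (wpsi W) (c *: d) = rproj _ (c%:A) * cin (wpsi W) d.
Proof.
rewrite /cin finjZ wpsi_scalable -[wpsi W _ in LHS]rprojK -rprojZ.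
by rewrite -[c *: zrepr _]mulr_algl rprojM rprojK.
Qed.

Lemma conormal_central c (m : conormal (rad A)) :
  lact (rproj _ (c%:A)) m = ract m (rproj _ (c%:A)).
Proof.
rewrite -[m]zreprK -[LHS]/(conormal_lact _ _) -[RHS]/(conormal_ract _ _).
rewrite conormal_lactE conormal_ractE; congr zproj; apply: val_inj => /=.
by rewrite mulr_algl mulr_algr.
Qed.

Lemma gabriel_central j i c (m : gabriel_bimod j i) : lact c%:A m = ract m c%:A.
Proof.
apply: val_inj; have Hm := sgtypeP m.
rewrite -[LHS]/(lact (cin (wpsi W) (c%:A : wD j)) (sgval m)).
rewrite -[RHS]/(ract (sgval m) (cin (wpsi W) (c%:A : wD i))).
rewrite !cinZ lactM ractM (corner1l (psi := wpsi W) Hm) -conormal_central.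
by rewrite lractA (corner1r (psi := wpsi W) Hm).
Qed.

Lemma enlarged_central j i c (m : enlarged_M j i) : lact c%:A m = ract m c%:A.
Proof. by apply: sandwich_central => d n; apply: gabriel_central. Qed.

Lemma gabriel_fin j i : fin_dim (gabriel_bimod j i).
Proof.
have HZ c x : rad A x -> rad A (c *: x).
  by move=> Hx; rewrite -mulr_algl; apply: idealMl.
have [U HU] := subspace_vspace (H := rad A) HZ.
pose X := conormal (rad A); pose r := \dim U.
have bin (l : 'I_r) : rad A (vbasis U)`_l.
  by apply/HU/vbasis_mem/mem_nth; rewrite size_tuple.
pose v l : X := zproj (square (rad A)) (to_sg (bin l)).
pose e (l : 'I_r) : X :=
  ract (lact (cin (wpsi W) (1 : wD j)) (v l)) (cin (wpsi W) (1 : wD i)).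
have Ce l : corner_sg (wpsi W) X j i (e l).
  by exists 1%N, (fun=> 1), (fun=> v l), (fun=> 1); rewrite big_ord1.
pose E l : gabriel_bimod j i := to_sg (Ce l).
apply: (@fin_dim_gen _ _ _ _ (codom E)) => H HC Hin m.
have spanX (x : X) : exists c : 'I_r -> k,
    x = \sum_l lact (rproj _ (c l)%:A) (v l).
  rewrite -[x]zreprK; move: (zrepr x) => y.
  have Uy : sgval y \in U by apply/HU/sgtypeP.
  exists (fun l => coord (vbasis U) l (sgval y)).
  pose w l := idMl ((coord (vbasis U) l (sgval y))%:A) (to_sg (bin l)).
  have ey : y = \sum_l w l.
    apply: val_inj; rewrite /= {1}(coord_vbasis Uy).
    rewrite (big_morph (@sgval _ _) (id1 := 0) (op1 := +%R)) //.
    by apply: eq_bigr => l _ /=; rewrite mulr_algl.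
  rewrite {1}ey (big_morph _ (@zprojD _ _) (zproj0 _)); apply: eq_bigr => l _.
  exact/esym/conormal_lactE.
have [c ec] := spanX (sgval m).
have -> : m = \sum_l lact (c l)%:A (E l).
  apply: val_inj.
  rewrite -[val m]/(sgval m) ((cornerP _ _ _ _).1 (sgtypeP m)).
  rewrite [X in lact _ X]ec lact_sum ract_sum.
  rewrite -[RHS]/(sgval _) (big_morph (@sgval _ _) (id1 := 0) (op1 := +%R)) //.
  apply: eq_bigr => l _.
  rewrite -[RHS]/(lact (cin (wpsi W) ((c l)%:A : wD j)) (e l)).
  rewrite cinZ lactM (corner1l (Ce l)) /e -lractA -!lactM.
  congr (ract (lact _ _) _).
  rewrite -[cin _ _]rprojK -!rprojM; congr rproj.
  by rewrite mulr_algl mulr_algr.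
by apply: sg_sum => l _; apply/HC/Hin/codom_f.
Qed.

Lemma enlarged_fin j i : fin_dim (enlarged_M j i).
Proof.
have [s Hs] := fin_dim_span (gabriel_fin j i).
apply: (@sandwich_fin k (wD j) (wD i)
  (bimod_res (in_alg (wD j)) (in_alg (wD i)) (gabriel_bimod j i))
  (@gabriel_central j i) s) => H HC Hin.
exact: (Hs H HC Hin).
Qed.

Definition enlarged_species : species k :=
  @Species k (wI W) (wI_inh W) (@wD _ _ W) (@wD_div _ _ W) enlarged_M
    enlarged_central enlarged_fin.

End Enlarged.

Definition projective (R : pzRingType) (P : lmodType R) : Prop :=
  forall (M N : lmodType R) (g : {linear M -> N}) (f : {linear P -> N}),
    (forall y, exists x, g x = y) ->
    exists h : {linear P -> M}, forall x, g (h x) = f x.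

Definition indecomposable (R : pzRingType) (P : lmodType R) : Prop :=
  (exists x : P, x != 0) /\
  forall (M N : lmodType R) (f : {linear P -> (M * N)%type}), bijective f ->
    (forall x : M, x = 0) \/ (forall y : N, y = 0).

(* The direct sum is finite because [R] is a finitely generated module. *)
Definition basic (R : pzRingType) : Prop :=
  exists (n : nat) (P : 'I_n -> lmodType R),
    [/\ forall i, projective (P i) /\ indecomposable (P i),
        forall i j, i != j -> ~ exists f : {linear P i -> P j}, bijective f &
        exists f : {linear R^o -> fprod (fun i => P i)}, bijective f].

Definition split_algebra (k : fieldType) (A : falgType k) : Prop :=
  exists eps : {rmorphism rquot (rad A) -> A},
    (forall (c : k) x, eps (c *: x) = c *: eps x) /\
    (forall x, rproj (rad A) (eps x) = x).

(* [A] and [B / I] are isomorphic [k]-algebras. *)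
Definition iso_to_quotient (k : fieldType) (A B : algType k) (I : ideal B) :
    Prop :=
  exists f : {rmorphism A -> rquot I},
    (forall (c : k) x, f (c *: x) = c *: f x) /\ bijective f.

(* Main.v *)
(* Let r be the radical, eps : A/r -> A the splitting and V = r^2.  The map
   x |-> x - projv V x kills r^2, so it is a k-linear section of r -> r/r^2.  It
   need not be bilinear over A/r, and this is why the bimodules are enlarged:
   d (x) m (x) d' |-> eps(d) (section m) eps(d') is bilinear for every k-linear
   section, hence extends to an algebra morphism phi : T -> A.

   Modulo r^(n+1) every element of r^n is in the image of phi, and r is
   nilpotent, so phi is onto.  It maps the n-th power of the ideal J of positive
   degree into r^n, and its kernel lies in J because eps(A/r) meets r in 0.  Finally
   each x in the kernel is the sum of its Peirce components e_b x e_a; these stay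
   in the kernel, and are sums of path tensors from a to b because x is in J. *)
From HB Require Import structures.
From Pilot Require Import Defs.
From mathcomp Require Import all_boot all_algebra all_field.
From mathcomp Require Import boolp classical_sets.
(* Repeated because MathComp has its own [fprod], [idealMl], [idealMr]. *)
Import Pilot.Defs.

Set Implicit Arguments.
Unset Strict Implicit.
Unset Printing Implicit Defensive.

Import GRing.Theory.
Local Open Scope classical_set_scope.
Local Open Scope ring_scope.

(** * Preimages of subgroups and powers of ideals *)

Section PreimageSubgroup.
Variables (V V' : zmodType) (f : V -> V') (fD : {morph f : x y / x + y}).
Variable H : subgroup V'.

Fact preim_sg0 : H (f 0).
Proof.
have -> : f 0 = 0 by apply: (addrI (f 0)); rewrite -fD !addr0.
exact: sg0.
Qed.

Fact preim_sgB x y : H (f x) -> H (f y) -> H (f (x - y)).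
Proof.
move=> Hx Hy; have -> : f (x - y) = f x - f y.
  by apply/(canRL (addrK _)); rewrite -fD subrK.
exact: sgB.
Qed.

(** The induction principles for tensor products range over subgroups; the preimage lets them prove
    that an additive image stays in [H]. *)
Definition preim_sg : subgroup V := @Subgroup V (fun x => H (f x)) preim_sg0 preim_sgB.

End PreimageSubgroup.

Section IdealPowerTheory.
Variable R : pzRingType.

Lemma ipow0 (I : subgroup R) n : ipow I n 0.
Proof. by case: n => [|n] //=; apply: iprod0. Qed.

Lemma ipowB (I : subgroup R) n x y : ipow I n x -> ipow I n y -> ipow I n (x - y).
Proof. by case: n => [|n] //=; apply: iprod_subgroup. Qed.

Definition ipow_sg (I : subgroup R) n : subgroup R :=
  @Subgroup R (ipow I n) (ipow0 I n) (@ipowB I n).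

Lemma ipow1 (I : ideal R) x : I x -> ipow I 1 x.
Proof. by move=> Ix; rewrite -[x]mulr1; apply: iprod_incl. Qed.

Lemma iprod_ipow2 (I : ideal R) : iprod I I `<=` ipow I 2.
Proof.
move=> _ [m [a [b [Hab ->]]]]; exists m, a, b; split=> // l.
by have [Ia Ib] := Hab l; split=> //; apply: ipow1.
Qed.

Lemma ipowMl (I : ideal R) n a x : ipow I n x -> ipow I n (a * x).
Proof.
case: n => [|n] //= [m [y [z [Hyz ->]]]].
exists m, (fun l => a * y l), z; split.
  by move=> l; have [? ?] := Hyz l; split=> //; apply: idealMl.
by rewrite mulr_sumr; apply: eq_bigr => l _; rewrite mulrA.
Qed.

Lemma ipowD (I : ideal R) m n x y :
  ipow I m x -> ipow I n y -> ipow I (m + n) (x * y).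
Proof.
elim: m x => [|m IHm] x; first by move=> _; apply: ipowMl.
move=> [p [a [b [Hab ->]]]] Hy; exists p, a, (fun l => b l * y); split.
  by move=> l; have [Ia Ib] := Hab l; split=> //; apply: IHm.
by rewrite mulr_suml; apply: eq_bigr => l _; rewrite mulrA.
Qed.

Lemma ipow_rmorphism (R' : pzRingType) (f : {rmorphism R -> R'}) (X : set R)
    (Y : set R') n :
  (forall x, X x -> Y (f x)) -> forall x, ipow X n x -> ipow Y n (f x).
Proof.
move=> fXY; elim: n => [|n IHn] x //= [m [a [b [Hab ->]]]].
exists m, (f \o a), (f \o b); split.
  by move=> l; have [? ?] := Hab l; split; [apply: fXY|apply: IHn].
by rewrite rmorph_sum; apply: eq_bigr => l _; rewrite rmorphM.
Qed.

End IdealPowerTheory.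

(** * Nilpotence of the radical of a finite dimensional algebra *)

Section RadicalNilpotent.
Variables (k : fieldType) (A : falgType k).

(** A left ideal [L'] of largest dimension strictly below that of [L] makes [L / L'] simple, and the
    Jacobson radical annihilates simple modules. *)
Lemma jacobson_lower_left_ideal (L : {vspace A}) :
  left_ideal [set x | x \in L] -> L != 0%VS ->
  exists L' : {vspace A}, [/\ left_ideal [set x | x \in L'],
    (\dim L' < \dim L)%N &
    forall a x, jacobson A a -> x \in L -> a * x \in L'].
Proof.
move=> [L0 LB LM] nzL.
have ideal0 : left_ideal [set x | x \in (0%VS : {vspace A})].
  split=> /= [|x y|a x]; first exact: mem0v.
    exact: rpredB.
  by rewrite !memv0 => /eqP ->; rewrite mulr0.
pose Q n := `[< exists U : {vspace A},
  [/\ left_ideal [set x | x \in U], (U <= L)%VS, (\dim U < \dim L)%N &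
      \dim U = n] >].
have Q0 : exists n, Q n.
  exists 0%N; apply/asboolP; exists 0%VS.
  by split; rewrite ?sub0v ?dimv0 // lt0n dimv_eq0.
have Qm n : Q n -> (n <= \dim L)%N by move=> /asboolP[U [_ _ /ltnW + <-]].
have [n /asboolP[L' [[L'0 L'B L'M] L'L dL' <-]] maxL'] := ex_maxnP Q0 Qm.
exists L'; split=> // a s Ja Ls.
have [L's|nL's] := boolP (s \in L'); first exact: L'M.
(* The annihilator of [s] modulo [L'] contains [a] as soon as it is a maximal left ideal. *)
apply: (Ja [set b | b * s \in L']); split.
- split=> /= [|x y|b x]; rewrite ?mul0r ?mulrBl -?mulrA //; first exact: L'B.
  exact: L'M.
- move=> E; have : [set b | b * s \in L'] 1 by rewrite E.
  by rewrite /= mul1r (negPf nL's).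
move=> K [K0 KB KM] sub.
have [KL'|nKL'] := pselect (forall b, K b -> b * s \in L').
  by left; apply/seteqP; split.
right; apply/seteqP; split=> // z _.
(* [U0] is [K s + L']. If its dimension were below that of [L], it would equal [L'] and [K] would
   annihilate [s] modulo [L']; so it is all of [L]. *)
pose U0 : set A := [set x | exists b l, [/\ K b, l \in L' & x = b * s + l]].
have U00 : U0 0 by exists 0, 0; split; rewrite ?mul0r ?addr0 ?mem0v.
have U0B x y : U0 x -> U0 y -> U0 (x - y).
  move=> [b [l [Kb Ll ->]]] [c [l' [Kc Ll' ->]]].
  exists (b - c), (l - l'); split; [exact: KB|exact: rpredB|].
  by rewrite mulrBl opprD addrACA.
have U0M c x : U0 x -> U0 (c * x).
  move=> [b [l [Kb Ll ->]]]; exists (c * b), (c * l).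
  by split; [exact: KM|exact: L'M|rewrite mulrDr mulrA].
have [|U HU] := @subspace_vspace k A (Subgroup U00 U0B).
  by move=> c x Hx; rewrite -mulr_algl; apply: U0M.
have idU : left_ideal [set x | x \in U].
  split=> /= [|x y|c x]; [exact: mem0v|exact: rpredB|].
  by move=> /HU Hx; apply/HU/U0M.
have UL : (U <= L)%VS.
  apply/subvP => _ /HU[b [l [_ Ll ->]]].
  by apply: rpredD; [apply: LM|apply: (subvP L'L)].
have L'U : (L' <= U)%VS.
  by apply/subvP => l Ll; apply/HU; exists 0, l; rewrite mul0r add0r.
have dU : (\dim L <= \dim U)%N.
  rewrite leqNgt; apply/negP => ltU; apply: nKL' => b Kb.
  have /maxL' le : Q (\dim U) by apply/asboolP; exists U.
  have /eqP -> : L' == U by rewrite eqEdim L'U.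
  by apply/HU; exists b, 0; rewrite mem0v addr0.
have /eqP eUL : U == L by rewrite eqEdim UL.
have /HU[b [l [Kb Ll es]]] : s \in U by rewrite eUL.
(* The equation [s = b * s + l] says that [1 - b] annihilates [s] modulo [L']. *)
have K1b : K (1 - b).
  by apply: sub; rewrite /= mulrBl mul1r {1}es addrC addKr.
have K1 : K 1.
  have -> : 1 = 1 - b - (0 - b) by rewrite sub0r opprK subrK.
  by apply: (KB) => //; apply: KB.
by rewrite -[z]mulr1; apply: KM.
Qed.

(** Each further power of the radical lies in a left ideal of smaller dimension until zero is
    reached, so the dimension of [A] bounds the number of steps. *)
Lemma jacobson_nilpotent : exists n, ipow (jacobson A) n = [set 0].
Proof.
have H n : exists L : {vspace A}, [/\ left_ideal [set x | x \in L],
    (\dim L + n <= \dim {:A})%N \/ L = 0%VS &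
    forall x, ipow (jacobson A) n x -> x \in L].
  elim: n => [|n [L [idL dL HL]]].
    exists fullv; split; [|by left; rewrite addn0|by move=> x _; apply: memvf].
    by split=> /= *; apply: memvf.
  have [L0|nL0] := eqVneq L 0%VS.
    exists L; split=> //; first by right.
    move=> _ [m [a [b [Hab ->]]]]; apply: rpred_sum => l _.
    have [_ /HL Lb] := Hab l; case: idL => _ _; exact.
  have [L' [idL' ltL' HL']] := jacobson_lower_left_ideal idL nL0.
  exists L'; split=> //.
    left; case: dL => [|e]; last by rewrite e eqxx in nL0.
    by apply: leq_trans; rewrite addnS -addSn leq_add2r.
  move=> _ [m [a [b [Hab ->]]]]; apply: rpred_sum => l _.
  by have [Ja /HL Lb] := Hab l; apply: HL'.
(* With one more than the dimension of [A], the inequality in [H] fails and [L] must be zero. *)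
exists (\dim {:A}).+1; have [L [_ dL HL]] := H (\dim {:A}).+1.
case: dL => [|L0]; first by rewrite addnS ltnNge leq_addl.
apply/seteqP; split=> [x /HL|x -> /=]; first by rewrite L0 memv0 => /eqP.
exact: (iprod0 (jacobson A)).
Qed.

(** Nilpotence excludes the default value in [rl], which is therefore a true minimum. *)
Lemma ipow_rl : ipow (jacobson A) (rl A) = [set 0].
Proof.
have ex : exists n, `[< ipow (jacobson A) n = [set 0] >].
  by have [n Hn] := jacobson_nilpotent; exists n; apply/asboolP.
rewrite /rl; case: pselect => [e|/(_ ex)] //.
by case: ex_minnP => n /asboolP.
Qed.

End RadicalNilpotent.

(** * The ring morphism on a tensor algebra induced by a ring morphism on [D] and a compatible map
    on [M] *)

Section TensorAlgebraLift.
Variables (D : pzRingType) (M : bimod D D) (R : pzRingType).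
Variables (e : {rmorphism D -> R}) (F : M -> R).
Hypothesis FD : {morph F : x y / x + y}.
Hypothesis Fl : forall d x, F (lact d x) = e d * F x.
Hypothesis Fr : forall x d, F (ract x d) = F x * e d.

Fixpoint tpow_lift (n : nat) : tpow M n -> R :=
  match n return tpow M n -> R with
  | 0 => fun d => e d
  | m.+1 => fun t =>
      @tens_lift _ _ _ M (tpow M m) R (fun x v => F x * tpow_lift v) t
  end.

(** Both properties go through one induction: balancedness in degree [n.+1] uses additivity and left
    linearity in degree [n]. *)
Lemma tpow_lift_props n :
  {morph @tpow_lift n : t u / t + u} /\
  (forall d (t : tpow M n), tpow_lift (lact d t) = e d * tpow_lift t).
Proof.
elim: n => [|n [IHD IHl]].
  by split=> [t u|d t]; [exact: (rmorphD e)|exact: (rmorphM e)].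
have bal : balanced (fun (x : M) (v : tpow M n) => F x * tpow_lift v).
  split=> [x x' v|x v v'|x a v]; first by rewrite FD mulrDl.
    by rewrite IHD mulrDr.
  by rewrite IHl Fr mulrA.
split=> [t u|d]; first exact: (tens_liftD bal).
apply: tpow_ext => [t u|t u|x v].
- rewrite lactDr; exact: (tens_liftD bal).
- by rewrite [X in _ * X](tens_liftD bal) mulrDr.
by rewrite lact_pure /= !(tens_lift_pure bal) Fl mulrA.
Qed.

Lemma tpow_liftD n : {morph @tpow_lift n : t u / t + u}.
Proof. by have [] := tpow_lift_props n. Qed.
Lemma tpow_lift_lact n d (t : tpow M n) : tpow_lift (lact d t) = e d * tpow_lift t.
Proof. by have [_ ->] := tpow_lift_props n. Qed.
Lemma tpow_lift0 n : tpow_lift (0 : tpow M n) = 0.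
Proof. by apply: (addrI (tpow_lift (0 : tpow M n))); rewrite -tpow_liftD !addr0. Qed.

Lemma tpow_lift_pure n x (v : tpow M n) :
  @tpow_lift n.+1 (pure x v) = F x * tpow_lift v.
Proof.
apply: (@tens_lift_pure _ _ _ M (tpow M n) R (fun x v => F x * tpow_lift v)).
split=> [y y' w|y w w'|y a w]; first by rewrite FD mulrDl.
  by rewrite tpow_liftD mulrDr.
by rewrite tpow_lift_lact Fr mulrA.
Qed.

Lemma tpow_lift_tmul m n (t : tpow M m) (u : tpow M n) :
  tpow_lift (tmul t u) = tpow_lift t * tpow_lift u.
Proof.
elim: m t => [|m IHm] t; first exact: tpow_lift_lact.
move: t; apply: tpow_ext => [t t'|t t'|x v].
- by rewrite tmulDl (@tpow_liftD (m.+1 + n)).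
- by rewrite tpow_liftD mulrDl.
by rewrite tmulSn [LHS](@tpow_lift_pure (m + n)) IHm tpow_lift_pure mulrA.
Qed.

Definition talg_lift (x : talg M) : R := \sum_(i < tbound x) tpow_lift (x i).

(** The bound [tbound] varies with the element, whereas additivity needs a common range of
    summation. *)
Lemma talg_liftE (x : talg M) N : (forall n, (N <= n)%N -> x n = 0) ->
  talg_lift x = \sum_(i < N) tpow_lift (x i).
Proof.
move=> HN; rewrite /talg_lift; set N' := tbound x.
have widen p q : (p <= q)%N -> (forall n, (p <= n)%N -> x n = 0) ->
    \sum_(i < p) tpow_lift (x i) = \sum_(i < q) tpow_lift (x i).
  move=> lepq x0; rewrite (big_ord_widen _ (fun i => tpow_lift (x i)) lepq).
  rewrite big_mkcond /=; apply: eq_bigr => i _.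
  by case: ltnP => // /x0 ->; rewrite tpow_lift0.
have [/widen|/ltnW/widen] := leqP N' N; first by apply; apply: tboundP.
by move=> -> //; apply: tboundP.
Qed.

Lemma talg_liftD : {morph talg_lift : x y / x + y}.
Proof.
move=> x y; set N := maxn (tbound x) (tbound y).
have Hx n : (N <= n)%N -> x n = 0.
  by rewrite geq_max => /andP[le _]; apply: tboundP.
have Hy n : (N <= n)%N -> y n = 0.
  by rewrite geq_max => /andP[_ le]; apply: tboundP.
rewrite (talg_liftE Hx) (talg_liftE Hy) (@talg_liftE _ N) -?big_split.
  by apply: eq_bigr => i _; rewrite tcompD tpow_liftD.
by move=> n le; rewrite tcompD Hx // Hy // addr0.
Qed.

Lemma talg_lift0 : talg_lift 0 = 0.
Proof. by apply: (addrI (talg_lift 0)); rewrite -talg_liftD !addr0. Qed.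
Lemma talg_liftN x : talg_lift (- x) = - talg_lift x.
Proof. by apply: (addrI (talg_lift x)); rewrite -talg_liftD !subrr talg_lift0. Qed.

Lemma talg_lift_tin n (u : tpow M n) : talg_lift (tin u) = tpow_lift u.
Proof.
rewrite (@talg_liftE _ n.+1) => [|j lt]; last by rewrite tin_out // ltn_eqF.
rewrite big_ord_recr big1 => [|i _]; last first.
  by rewrite tin_out ?tpow_lift0 //= gtn_eqF.
by rewrite [LHS]add0r; congr tpow_lift; apply: tinE.
Qed.

Lemma talg_liftM : {morph talg_lift : x y / x * y}.
Proof.
move=> x y; elim/talg_ind: x => [|x x' IH IH'|m u].
- by rewrite mul0r talg_lift0 mul0r.
- by rewrite mulrDl !talg_liftD mulrDl IH IH'.
elim/talg_ind: y => [|y y' IH IH'|n v].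
- by rewrite mulr0 talg_lift0 mulr0.
- by rewrite mulrDr !talg_liftD mulrDr IH IH'.
by rewrite tinM !talg_lift_tin tpow_lift_tmul.
Qed.

Lemma talg_lift1 : talg_lift 1 = 1.
Proof. by rewrite talg_lift_tin [LHS](rmorph1 e). Qed.

Lemma talg_lift_tgen x : talg_lift (tgen x) = F x.
Proof.
rewrite talg_lift_tin [LHS]tpow_lift_pure.
by rewrite [X in _ * X](rmorph1 e) mulr1.
Qed.

Fact talg_lift_zmod : zmod_morphism talg_lift.
Proof. by move=> x y; rewrite talg_liftD talg_liftN. Qed.
Fact talg_lift_monoid : monoid_morphism talg_lift.
Proof. by split; [exact: talg_lift1|exact: talg_liftM]. Qed.

Definition talg_lift_rmorphism : {rmorphism talg M -> R} :=
  HB.pack talg_lift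
    (GRing.isZmodMorphism.Build (talg M) R talg_lift talg_lift_zmod)
    (GRing.isMonoidMorphism.Build (talg M) R talg_lift talg_lift_monoid).

(** Every pure tensor of positive degree starts with a factor that [F] sends into [I], and the
    component of degree zero vanishes. *)
Lemma talg_lift_tplus (I : ideal R) (x : talg M) :
  (forall m, I (F m)) -> tplus M x -> I (talg_lift x).
Proof.
move=> IF x0; apply: sg_sum => -[[|n] lt] _ /=.
  by rewrite [x _]x0 [X in I X](rmorph0 e); apply: sg0.
apply: (@tens_ind _ _ _ _ _ (preim_sg (@tpow_liftD n.+1) I)) => y v.
by rewrite /= [X in I X]tpow_lift_pure; apply: idealMr.
Qed.

End TensorAlgebraLift.

(* Stated for an abstract ring because in a tensor algebra the product unfolds
   to a sum, which misleads rewriting with distributivity. *)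
Lemma sg_mul_sum (R : pzRingType) (H : subgroup R) (J : finType) (F : J -> R)
    (u z w : R) :
  (forall j, H (u * (F j * z) * w)) -> H (u * ((\sum_j F j) * z) * w).
Proof.
by move=> HF; rewrite mulr_suml mulr_sumr mulr_suml; apply: sg_sum => j _.
Qed.

(** Peirce decomposition: multiply [x] on both sides by [1], written as the sum of the [e j]. *)
Lemma sg_peirce (R : pzRingType) (H : subgroup R) (J : finType) (e : J -> R) x :
  \sum_j e j = 1 -> (forall i j, H (e j * x * e i)) -> H x.
Proof.
move=> e1 Hx; rewrite -[x]mulr1 -[x]mul1r -e1 mulr_suml mulr_suml.
by apply: sg_sum => j _; rewrite mulr_sumr; apply: sg_sum.
Qed.

Lemma fprod_sum (I : Type) (V : I -> zmodType) (J : Type) (r : seq J)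
    (P : pred J) (F : J -> fprod (fun i => V i)) i :
  (\sum_(j <- r | P j) F j : fprod (fun i => V i)) i = \sum_(j <- r | P j) F j i.
Proof. exact: (big_morph (fun x : fprod (fun a : I => V a) => x i)). Qed.

Lemma fprod_finj (I : finType) (V : I -> zmodType) (x : fprod (fun i => V i)) :
  x = \sum_i (finj (V := V) (x i) : fprod (fun i => V i)).
Proof.
apply: functional_extensionality_dep => i; rewrite fprod_sum.
rewrite (bigD1 i) //= finjE big1 ?addr0 // => j ne.
by rewrite finj_out.
Qed.

(** * Path tensors, and generation of ideals by relations *)

Section PathTensors.
Variables (k : fieldType) (S : species k).
Local Notation D := (sring S).
Local Notation M := (sbimod S).
Local Notation T := (tensor_algebra S).

Definition tdiag (d : D) : T := tin (d : tpow M 0).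
Definition sring_idem (i : sI S) : D := finj (V := fun i => sD S i : zmodType) (1 : sD S i).
(** The trivial path at [i], an idempotent of the tensor algebra. *)
Definition vertex (i : sI S) : T := tdiag (sring_idem i).

Lemma tdiagM d d' : tdiag d * tdiag d' = tdiag (d * d').
Proof. exact: tinM. Qed.

Lemma tdiag_sum (J : finType) (F : J -> D) : tdiag (\sum_j F j) = \sum_j tdiag (F j).
Proof. exact: (big_morph tdiag (@tinD _ M 0) (@tin0 _ M 0)). Qed.

Lemma sum_vertex : \sum_i vertex i = 1.
Proof.
by rewrite -tdiag_sum; congr tin; apply/esym/(@fprod_finj _ (fun i => sD S i : zmodType)).
Qed.

Lemma tgenD (x y : M) : tgen (x + y) = tgen x + tgen y :> T.
Proof. by rewrite -tinD; congr tin; apply: pureDl. Qed.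
Lemma tgen0 : tgen (0 : M) = 0 :> T.
Proof. by apply: (addrI (tgen (0 : M) : T)); rewrite -tgenD !addr0. Qed.

Lemma tin_pure n (x : M) (v : tpow M n) :
  tin (pure x v : tpow M n.+1) = tgen x * tin v :> T.
Proof. by rewrite [RHS]tinM tmulSn tmul0n lact1. Qed.

Lemma tdiag_tgen d (x : M) : tdiag d * tgen x = tgen (lact d x) :> T.
Proof. by rewrite [LHS]tinM; congr tin; rewrite tmul0n lact_pure. Qed.

Lemma tgen_tdiag (x : M) d : tgen x * tdiag d = tgen (ract x d) :> T.
Proof.
rewrite -tin_pure; congr tin; rewrite pureA; congr pure.
exact/esym/(mulr1 (d : D)).
Qed.

Lemma tdiag_sgen d j i (m : sM S j i) : tdiag d * sgen m = sgen (lact (d j) m).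
Proof.
rewrite tdiag_tgen; congr tgen; apply: functional_extensionality_dep => p.
rewrite -[LHS]/(lact (d p.1)
  (finj (V := fun p : sI S * sI S => sM S p.1 p.2) (i := (j, i)) m p)).
have [<-|ne] := eqVneq (j, i) p; first by rewrite !finjE.
by rewrite !finj_out // lact0.
Qed.

Lemma sgen_tdiag d j i (m : sM S j i) : sgen m * tdiag d = sgen (ract m (d i)).
Proof.
rewrite tgen_tdiag; congr tgen; apply: functional_extensionality_dep => p.
rewrite -[LHS]/(ract
  (finj (V := fun p : sI S * sI S => sM S p.1 p.2) (i := (j, i)) m p) (d p.2)).
have [<-|ne] := eqVneq (j, i) p; first by rewrite !finjE.
by rewrite !finj_out // ract0.
Qed.

Lemma sgen0 j i : sgen (0 : sM S j i) = 0.
Proof.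
rewrite -[RHS]tgen0; congr tgen; apply: functional_extensionality_dep => p.
have [<-|ne] := eqVneq (j, i) p; first by rewrite finjE.
by rewrite finj_out.
Qed.

(** The sign is the left action of the diagonal element [- 1], so [tdiag_sgen] turns it into a
    product. *)
Lemma sgenN j i (m : sM S j i) : sgen (- m) = - sgen m.
Proof.
have -> : - m = lact (((- 1 : D) : sring S) j) m.
  by rewrite -[(- 1 : D) j]/(- (1 : sD S j)) lactNl lact1.
rewrite -tdiag_sgen -[RHS]mulN1r; congr (_ * _).
by apply: (addrI (1 : T)); rewrite subrr -[LHS]tinD subrr tin0.
Qed.

Lemma tgen_sum_sgen (x : M) : tgen x = \sum_p sgen (j := p.1) (i := p.2) (x p) :> T.
Proof.
rewrite {1}(@fprod_finj _ (fun p : sI S * sI S => sM S p.1 p.2 : zmodType) x).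
rewrite (big_morph (fun x => tgen x : T) tgenD tgen0).
by apply: eq_bigr => -[j i].
Qed.

Lemma vertex_sgen b j i (m : sM S j i) : b != j -> vertex b * sgen m = 0.
Proof. by move=> ne; rewrite tdiag_sgen [X in lact X]finj_out // lact0l sgen0. Qed.
Lemma sgen_vertex j i (m : sM S j i) : sgen m * vertex i = sgen m.
Proof. by rewrite sgen_tdiag [X in ract _ X]finjE ract1. Qed.
Lemma vertex_sgenK j i (m : sM S j i) : vertex j * sgen m = sgen m.
Proof. by rewrite tdiag_sgen [X in lact X]finjE lact1. Qed.

(** The leftmost arrow absorbs the sign; this makes sums of path tensors closed under
    subtraction. *)
Lemma path_tensorN a b (g : T) : path_tensor a b g -> path_tensor a b (- g).
Proof.
case=> [c m am|c d m g' am Hg']; first by rewrite -sgenN; constructor.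
by rewrite -mulNr -sgenN; constructor.
Qed.

(** Unlike [relation_from_to], this allows the empty sum, so that the path sums from [a] to [b] form
    a subgroup. *)
Definition path_sum_set (a b : sI S) : set T :=
  [set x | exists n (g : 'I_n -> T), (forall l, path_tensor a b (g l)) /\
     x = \sum_l g l].

Fact path_sum0 a b : path_sum_set a b 0.
Proof. by exists 0%N, (fun=> 0); split; [case|rewrite big_ord0]. Qed.

Fact path_sumB a b x y :
  path_sum_set a b x -> path_sum_set a b y -> path_sum_set a b (x - y).
Proof.
move=> [n [g [Hg ->]]] [m [h [Hh ->]]].
exists (n + m)%N, (fun l => match split l with inl i => g i | inr j => - h j end).
split; first by move=> l; case: (split l) => i //; apply: path_tensorN.
rewrite big_split_ord /= -sumrN; congr (_ + _); apply: eq_bigr => i _.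
  by rewrite (unsplitK (inl i)).
by rewrite (unsplitK (inr i)).
Qed.

Definition path_sum a b : subgroup T :=
  @Subgroup T (path_sum_set a b) (path_sum0 a b) (@path_sumB a b).

(** A path tensor requires an arrow, hence a nonzero element of the bimodule; for [m = 0] the empty
    sum takes over. *)
Lemma path_sum_sgen a b (m : sM S b a) : path_sum a b (sgen m).
Proof.
have [->|nz] := eqVneq m 0; first by rewrite sgen0; apply: sg0.
exists 1%N, (fun=> sgen m); split; last by rewrite big_ord1.
by move=> _; constructor; exists m.
Qed.

Lemma path_sum_cons a b c (m : sM S c b) x :
  path_sum a b x -> path_sum a c (sgen m * x).
Proof.
have [->|nz] := eqVneq m 0; first by rewrite sgen0 mul0r => _; apply: sg0.
move=> [n [g [Hg ->]]]; exists n, (fun l => sgen m * g l).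
by split; [move=> l; constructor=> //; exists m|rewrite mulr_sumr].
Qed.

(** The vertex [b] on the left keeps only the arrows ending at [b]. Inserting the source [c] of such
    an arrow on its right leaves [z] cut between [c] and [a], ready for an induction on the
    degree. *)
Lemma path_sum_tgen a b (x : M) (z : T) :
  (forall c (m : sM S b c),
     path_sum a b (sgen m * (vertex c * z * vertex a))) ->
  path_sum a b (vertex b * (tgen x * z) * vertex a).
Proof.
move=> Hz; rewrite tgen_sum_sgen; apply: sg_mul_sum => -[j i] /=.
move: (x (j, i)) => /= m.
have [e|ne] := eqVneq b j; last first.
  rewrite mulrA vertex_sgen // !mul0r; exact: path_sum0.
case: j / e m => m; have := Hz i m.
rewrite -(mulrA (vertex i)) (mulrA (sgen m)) sgen_vertex.
by rewrite (mulrA (vertex b)) vertex_sgenK -(mulrA (sgen m)).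
Qed.

Lemma path_sum_tin_step n a b :
  (forall c (v : tpow M n) (m : sM S b c),
     path_sum a b (sgen m * (vertex c * tin v * vertex a))) ->
  forall u : tpow M n.+1, path_sum a b (vertex b * tin u * vertex a).
Proof.
move=> Hv; have bD : {morph (fun t : tpow M n.+1 => vertex b * tin t * vertex a : T) :
    t u / t + u} by move=> t u; rewrite tinD mulrDr mulrDl.
apply: (@tens_ind _ _ _ _ _ (preim_sg bD (path_sum a b))) => x v.
rewrite /= tin_pure; exact: path_sum_tgen.
Qed.

(** Induction on the degree peels off the leftmost arrow; the remaining tensor then ends at the
    source of that arrow. *)
Lemma path_sum_tin n (u : tpow M n.+1) a b :
  path_sum a b (vertex b * tin u * vertex a).
Proof.
elim: n u b => [|n IHn] u b; apply: path_sum_tin_step => c v m; last first.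
  exact: path_sum_cons.
(* In degree one the remaining factor is a diagonal element cut by [c] and [a]: it acts on the arrow
   when [a = c] and vanishes otherwise. *)
have -> : vertex c * tin v * vertex a =
    tdiag (sring_idem c * (v : D) * sring_idem a).
  by rewrite -[tin v]/(tdiag v) !tdiagM.
rewrite sgen_tdiag.
have [e|ne] := eqVneq a c; first by case: c / e m => m; apply: path_sum_sgen.
have -> : (sring_idem c * (v : D) * sring_idem a) c = 0.
  rewrite -[LHS]/((sring_idem c * (v : D)) c * sring_idem a c).
  by rewrite [X in _ * X]finj_out // mulr0.
by rewrite ract0r sgen0; apply: sg0.
Qed.

Lemma path_sum_tideal (x : T) a b :
  tideal S x -> path_sum a b (vertex b * x * vertex a).
Proof.
move=> x0; rewrite (talg_sum (@tboundP _ _ x)).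
(* The inserted [1] plays the role of [z] in [sg_mul_sum]. *)
rewrite -[X in vertex b * X]mulr1; apply: sg_mul_sum => -[[|n] lt] /=.
  rewrite mulr1 x0 tin0 mulr0 mul0r; exact: path_sum0.
rewrite mulr1; exact: path_sum_tin.
Qed.

(** The Peirce components of an element of [K] stay in [K], and since [K] has nothing in degree zero
    they are sums of path tensors. *)
Lemma relation_ideal_generated (K : ideal T) :
  K `<=` tideal S -> gen_ideal [set x | K x /\ is_relation x] = K :> set T.
Proof.
move=> KJ; apply/seteqP; split=> [x /(_ K)|x Kx]; first by apply=> y [].
set G := gen_ideal _.
have Gab a b : G (vertex b * x * vertex a).
  have Kab : K (vertex b * x * vertex a) by apply: idealMr; apply: idealMl.
  have [[|n] [g [Hg e]]] := path_sum_tideal a b (KJ _ Kx).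
    (* A relation needs at least one summand; the empty sum is zero, which lies in every ideal. *)
    by rewrite e big_ord0; apply: sg0.
  by move=> I; apply; split=> //; exists a, b, n, g.
exact: (sg_peirce sum_vertex Gab).
Qed.

End PathTensors.

(** * Lifting a triple of [k]-linear maps to a sandwich bimodule *)

Section SandwichLift.
Variables (k : fieldType) (B C : falgType k) (N : bimod k k) (R : algType k).
Variables (b : B -> R) (s : N -> R) (c : C -> R).
Hypotheses (bD : {morph b : x y / x + y}) (bZ : scalable b).
Hypotheses (sD : {morph s : x y / x + y}).
Hypothesis sZl : forall a n, s (lact a n) = a *: s n.
Hypothesis sZr : forall a n, s (ract n a) = a *: s n.
Hypotheses (cD : {morph c : x y / x + y}) (cZ : scalable c).

Let left_lift : tens (alg_left B) N -> R :=
  @tens_lift _ _ _ (alg_left B) N R (fun x n => b x * s n).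

Let left_bal : @balanced _ _ _ (alg_left B) N R (fun x n => b x * s n).
Proof.
split=> [x x' n|x n n'|x a n]; first by rewrite bD mulrDl.
  by rewrite sD mulrDr.
by rewrite -[ract x a]/(a *: (x : B)) bZ sZl -scalerAl -scalerAr.
Qed.

(** For the outer lift to be balanced, scalars acting on the right of the inner tensor must come
    out; they reach [s] through [sZr]. *)
Let left_liftZ a u : left_lift (ract u a) = a *: left_lift u.
Proof.
move: u; apply: tens_ext => [u v|u v|x n].
- by rewrite ractDl; apply: (tens_liftD left_bal).
- by rewrite [left_lift _](tens_liftD left_bal) scalerDr.
rewrite ract_pure [LHS](tens_lift_pure left_bal).
by rewrite [left_lift _](tens_lift_pure left_bal) sZr scalerAr.
Qed.

(** Lifted in two stages, following the bracketing of [sandwich]. *)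
Definition sandwich_lift : sandwich B C N -> R :=
  @tens_lift _ _ _ (tens (alg_left B) N) (alg_right C) R
    (fun u y => left_lift u * c y).

Let outer_bal : @balanced _ _ _ (tens (alg_left B) N) (alg_right C) R
  (fun u y => left_lift u * c y).
Proof.
split=> [u u' y|u y y'|u a y].
- by rewrite [left_lift _](tens_liftD left_bal) mulrDl.
- by rewrite cD mulrDr.
by rewrite left_liftZ -[lact a y]/(a *: (y : C)) cZ -scalerAl -scalerAr.
Qed.

Lemma sandwich_liftD : {morph sandwich_lift : t u / t + u}.
Proof. exact: (tens_liftD outer_bal). Qed.

Lemma sandwich_lift_pure3 x n y : sandwich_lift (pure3 x n y) = b x * s n * c y.
Proof.
rewrite [LHS](tens_lift_pure outer_bal); congr (_ * _).
exact: (tens_lift_pure left_bal).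
Qed.

Lemma sandwich_ext (f g : sandwich B C N -> R) :
  {morph f : t u / t + u} -> {morph g : t u / t + u} ->
  (forall x n y, f (pure3 x n y) = g (pure3 x n y)) -> forall t, f t = g t.
Proof.
move=> fD gD fg; apply: tens_ext => // u y; move: u.
apply: tens_ext => [u v|u v|x n]; rewrite ?(@pureDl _ _ _ (tens (alg_left B) N)) //.
exact: fg.
Qed.

Hypothesis bM : {morph b : x y / x * y}.
Hypothesis cM : {morph c : x y / x * y}.

(** The action only touches the outer factor, where [b] is multiplicative; so a merely [k]-linear
    [s] still yields a map linear over [B]. *)
Lemma sandwich_lift_lact x t : sandwich_lift (lact x t) = b x * sandwich_lift t.
Proof.
move: t; apply: sandwich_ext => [t u|t u|y n z].
- by rewrite lactDr sandwich_liftD.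
- by rewrite sandwich_liftD mulrDr.
by rewrite lact_pure3 !sandwich_lift_pure3 bM !mulrA.
Qed.

Lemma sandwich_lift_ract t z : sandwich_lift (ract t z) = sandwich_lift t * c z.
Proof.
move: t; apply: sandwich_ext => [t u|t u|x n y].
- by rewrite ractDl sandwich_liftD.
- by rewrite sandwich_liftD mulrDl.
by rewrite ract_pure3 !sandwich_lift_pure3 cM !mulrA.
Qed.

End SandwichLift.

(** * A [k]-linear section from the radical modulo its square back to the radical *)

Section RadicalSection.
Variables (k : fieldType) (A : falgType k) (V : {vspace A}).
Hypothesis VP : forall x, x \in V <-> iprod (rad A) (rad A) x.
Local Notation r := (rad A).

Definition rad_section (m : conormal r) : A :=
  let x := sgval (zrepr m) in x - projv V x.

(** Two representatives differ by an element of [V], where [projv V] is the identity, so the choice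
    made by [zrepr] does not matter. *)
Lemma rad_sectionE (x : sgtype r) :
  rad_section (zproj (square r) x) = sgval x - projv V (sgval x).
Proof.
have /VP : square r (zrepr (zproj (square r) x) - x) by apply: zproj_repr.
move=> Vd; apply/eqP; rewrite /rad_section -subr_eq0 opprD addrACA -opprD.
by rewrite -[X in _ - X]linearB subr_eq0; apply/eqP/esym/projv_id.
Qed.

Lemma rad_sectionD : {morph rad_section : m n / m + n}.
Proof.
move=> m n; rewrite -[m]zreprK -[n]zreprK -zprojD !rad_sectionE /=.
by rewrite linearD opprD addrACA.
Qed.

Lemma rad_sectionZ a m : rad_section (lact (rproj r a%:A) m) = a *: rad_section m.
Proof.
rewrite -[m]zreprK [lact _ _]conormal_lactE !rad_sectionE /=.
by rewrite mulr_algl linearZ scalerBr.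
Qed.

Lemma rad_section_rad m : r (rad_section m).
Proof.
apply: sgB; first exact: sgtypeP.
have /VP := memv_proj V (sgval (zrepr m)).
by move=> [n [x [y [Hxy ->]]]]; apply: sg_sum => l _; apply: idealMr; case: (Hxy l).
Qed.

End RadicalSection.

(** The first isomorphism theorem, oriented from [A] to the quotient: the map picks a preimage under
    [phi], and two preimages differ by an element of [I]. *)
Lemma iso_to_quotient_ker (k : fieldType) (A B : algType k)
    (phi : {rmorphism B -> A}) (I : ideal B) :
  scalable phi -> (forall a, exists b, phi b = a) ->
  (forall b, I b <-> phi b = 0) -> iso_to_quotient A I.
Proof.
move=> phiZ surj kerP.
pose f (a : A) := rproj I (projT1 (cid (surj a))).
have fE b : f (phi b) = rproj I b.
  rewrite /f; case: cid => b' /= e; apply/rproj_eq/kerP.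
  by rewrite rmorphB e subrr.
have fB : zmod_morphism f.
  move=> a a'; have [[b <-] [b' <-]] := (surj a, surj a').
  by rewrite -rmorphB !fE; exact: zprojB.
have fM : monoid_morphism f.
  split=> [|a a']; first by rewrite -(rmorph1 phi) fE.
  by have [[b <-] [b' <-]] := (surj a, surj a'); rewrite -rmorphM !fE rprojM.
pose F : {rmorphism A -> rquot I} := HB.pack f
  (GRing.isZmodMorphism.Build A (rquot I) f fB)
  (GRing.isMonoidMorphism.Build A (rquot I) f fM).
exists F; split.
  by move=> c a; have [b <-] := surj a; rewrite /= -phiZ !fE rprojZ.
exists (fun q => phi (zrepr q)) => [a|q] /=; last by rewrite fE rprojK.
have [b <-] := surj a; rewrite fE.
apply/eqP; rewrite -subr_eq0 -rmorphB; apply/eqP/kerP.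
exact: zproj_repr.
Qed.

(** * The map from the arrows of the enlarged species to [A] *)

Section Presentation.
Variables (k : fieldType) (A : falgType k).
Variable eps : {rmorphism rquot (rad A) -> A}.
Hypothesis epsZ : forall (c : k) x, eps (c *: x) = c *: eps x.
Hypothesis epsK : forall x, rproj (rad A) (eps x) = x.
Variables (W : wedderburn A) (V : {vspace A}).
Hypothesis VP : forall x, x \in V <-> iprod (rad A) (rad A) x.
Local Notation S := (enlarged_species W).
Local Notation D := (sring S).
Local Notation M := (sbimod S).
Local Notation T := (tensor_algebra S).
Local Notation r := (rad A).
Local Notation N j i :=
  (bimod_res (in_alg (wD j)) (in_alg (wD i)) (gabriel_bimod j i)).

Definition diag_map : {rmorphism D -> A} := eps \o wpsi W.

(** This embedding sends [1] to an idempotent, in general not to [1], so its properties are stated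
    one by one instead of being bundled in a ring morphism. *)
Definition corner_map (i : wI W) (d : wD i) : A := eps (cin (wpsi W) d).

Lemma corner_mapD i : {morph @corner_map i : x y / x + y}.
Proof. by move=> x y; rewrite /corner_map cinD rmorphD. Qed.
Lemma corner_mapM i : {morph @corner_map i : x y / x * y}.
Proof. by move=> x y; rewrite /corner_map cinM rmorphM. Qed.
Lemma corner_mapZ i : scalable (@corner_map i).
Proof. by move=> c x; rewrite /corner_map /cin finjZ wpsi_scalable epsZ. Qed.

Lemma diag_map_corner (d : D) i (x : wD i) :
  diag_map d * corner_map x = corner_map (d i * x).
Proof.
rewrite /diag_map /= /corner_map -rmorphM -rmorphM; congr (eps (wpsi W _)).
apply: functional_extensionality_dep => l.
rewrite -[LHS]/(d l * finj (V := fun i => wD i) x l).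
by have [<-|ne] := eqVneq i l; rewrite ?finjE // !finj_out // mulr0.
Qed.

Lemma corner_diag_map (d : D) i (x : wD i) :
  corner_map x * diag_map d = corner_map (x * d i).
Proof.
rewrite /diag_map /= /corner_map -rmorphM -rmorphM; congr (eps (wpsi W _)).
apply: functional_extensionality_dep => l.
rewrite -[LHS]/(finj (V := fun i => wD i) x l * d l).
by have [<-|ne] := eqVneq i l; rewrite ?finjE // !finj_out // mul0r.
Qed.

Lemma sum_corner_map1 : \sum_i corner_map (1 : wD i) = 1.
Proof.
rewrite -(rmorph1 diag_map) /diag_map /= /corner_map /cin.
rewrite -!raddf_sum; congr (eps (wpsi W _)).
exact/esym/(@fprod_finj _ (fun i => wD i : zmodType)).
Qed.

Definition gabriel_section (j i : wI W) (n : gabriel_bimod j i) : A :=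
  rad_section V (sgval n).

Definition arrow_map (j i : wI W) : enlarged_M j i -> A :=
  @sandwich_lift k (wD j) (wD i) (N j i) A
    (@corner_map j) (@gabriel_section j i) (@corner_map i).

Lemma gabriel_sectionD (j i : wI W) : {morph @gabriel_section j i : m n / m + n}.
Proof. by move=> m n; apply: rad_sectionD. Qed.

(** The scalar [c] of [wD j] acts as [c] times the idempotent of [j], and that idempotent fixes the
    corner. *)
Lemma gabriel_sectionZ (j i : wI W) c (m : gabriel_bimod j i) :
  gabriel_section (lact c%:A m) = c *: gabriel_section m.
Proof.
rewrite /gabriel_section -rad_sectionZ //; congr rad_section.
rewrite -[LHS]/(lact (cin (wpsi W) (c%:A : wD j)) (sgval m)) cinZ lactM.
by rewrite (corner1l (psi := wpsi W) (sgtypeP m)).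
Qed.

Lemma gabriel_sectionZr (j i : wI W) c (m : gabriel_bimod j i) :
  gabriel_section (ract m c%:A) = c *: gabriel_section m.
Proof. by rewrite -gabriel_central gabriel_sectionZ. Qed.

Lemma arrow_mapD (j i : wI W) : {morph @arrow_map j i : t u / t + u}.
Proof.
apply: sandwich_liftD; [exact: corner_mapD|exact: corner_mapZ|
  exact: gabriel_sectionD|exact: gabriel_sectionZ|exact: gabriel_sectionZr|
  exact: corner_mapD|exact: corner_mapZ].
Qed.

Lemma arrow_map_pure3 j i x (n : N j i) y :
  arrow_map (pure3 x n y) = corner_map x * gabriel_section n * corner_map y.
Proof.
apply: sandwich_lift_pure3; [exact: corner_mapD|exact: corner_mapZ|
  exact: gabriel_sectionD|exact: gabriel_sectionZ|exact: gabriel_sectionZr|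
  exact: corner_mapD|exact: corner_mapZ].
Qed.

Lemma arrow_map_lact (j i : wI W) x (t : enlarged_M j i) :
  arrow_map (lact x t) = corner_map x * arrow_map t.
Proof.
apply: sandwich_lift_lact; [exact: corner_mapD|exact: corner_mapZ|
  exact: gabriel_sectionD|exact: gabriel_sectionZ|exact: gabriel_sectionZr|
  exact: corner_mapD|exact: corner_mapZ|exact: corner_mapM].
Qed.

Lemma arrow_map_ract (j i : wI W) (t : enlarged_M j i) x :
  arrow_map (ract t x) = arrow_map t * corner_map x.
Proof.
apply: sandwich_lift_ract; [exact: corner_mapD|exact: corner_mapZ|
  exact: gabriel_sectionD|exact: gabriel_sectionZ|exact: gabriel_sectionZr|
  exact: corner_mapD|exact: corner_mapZ|exact: corner_mapM].
Qed.

Lemma arrow_map_rad (j i : wI W) (t : enlarged_M j i) : r (arrow_map t).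
Proof.
apply: (@sandwich_ind _ _ _ (N j i) (preim_sg (@arrow_mapD j i) r)) => x n y.
apply: (eq_ind_r (fun a => r a) _ (arrow_map_pure3 x n y)).
by apply: idealMr; apply: idealMl; apply: (rad_section_rad VP).
Qed.

(** The image of the unit of [wD j] can be inserted in front of [arrow_map t], and it cuts [d] down
    to its component [d j]. *)
Lemma diag_map_arrow (j i : wI W) (d : D) (t : enlarged_M j i) :
  diag_map d * arrow_map t = arrow_map (lact (d j) t).
Proof.
have e1 : corner_map (1 : wD j) * arrow_map t = arrow_map t.
  exact: etrans (esym (arrow_map_lact 1 t)) (congr1 _ (lact1 t)).
have e2 : diag_map d * corner_map (1 : wD j) = corner_map (d j).
  exact: etrans (diag_map_corner d 1) (congr1 _ (mulr1 (d j))).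
by rewrite [RHS]arrow_map_lact -e2 -[RHS]mulrA; congr (_ * _); apply/esym.
Qed.

Lemma arrow_diag_map (j i : wI W) (d : D) (t : enlarged_M j i) :
  arrow_map t * diag_map d = arrow_map (ract t (d i)).
Proof.
have e1 : arrow_map t * corner_map (1 : wD i) = arrow_map t.
  exact: etrans (esym (arrow_map_ract t 1)) (congr1 _ (ract1 t)).
have e2 : corner_map (1 : wD i) * diag_map d = corner_map (d i).
  exact: etrans (corner_diag_map d 1) (congr1 _ (mul1r (d i))).
by rewrite [RHS]arrow_map_ract -e2 [RHS]mulrA; congr (_ * _); apply/esym.
Qed.

Definition arrows_map (x : M) : A := \sum_p arrow_map (j := p.1) (i := p.2) (x p).

Lemma arrows_mapD : {morph arrows_map : x y / x + y}.
Proof.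
by move=> x y; rewrite -big_split; apply: eq_bigr => p _; apply: arrow_mapD.
Qed.

Lemma arrows_map_lact d x : arrows_map (lact d x) = diag_map d * arrows_map x.
Proof.
rewrite mulr_sumr; apply: eq_bigr => p _.
exact/esym/diag_map_arrow.
Qed.

Lemma arrows_map_ract x d : arrows_map (ract x d) = arrows_map x * diag_map d.
Proof.
rewrite mulr_suml; apply: eq_bigr => p _.
exact/esym/arrow_diag_map.
Qed.

Lemma arrows_map_rad x : r (arrows_map x).
Proof. by apply: sg_sum => p _; apply: arrow_map_rad. Qed.

(** Each Peirce component [y j i] of [a] has its class in the corner of [j] and [i], and the section
    of that class returns the component up to an element of [V]. Hence the arrows generate the
    radical modulo its square. *)
Lemma arrows_map_generate a : r a -> exists x, iprod r r (a - arrows_map x).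
Proof.
move=> ra; pose E i := corner_map (1 : wD i).
have EE i : E i * E i = E i by rewrite /E -corner_mapM mulr1.
pose y (j i : wI W) := E j * a * E i.
have yE j i : y j i = E j * y j i * E i.
  by rewrite /y !mulrA EE -(mulrA _ (E i)) EE.
have Hy j i : r (y j i) by apply: idealMr; apply: idealMl.
pose m j i : conormal r := zproj (square r) (to_sg (Hy j i)).
have Cm j i : corner_sg (wpsi W) (conormal r) j i (m j i).
  (* By [epsK] the idempotents of the quotient are the classes of [E j] and [E i], so both actions
     can be computed on representatives. *)
  apply/cornerP; rewrite -[cin _ (1 : wD j)]epsK -[cin _ (1 : wD i)]epsK.
  rewrite [lact _ _]conormal_lactE [RHS]conormal_ractE.
  congr zproj; apply: val_inj.
  exact: yE.
pose x : M := fun p => @pure3 k _ _ (N p.1 p.2) 1 (to_sg (Cm p.1 p.2)) 1.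
exists x.
have -> : arrows_map x =
    \sum_p E p.1 * (y p.1 p.2 - projv V (y p.1 p.2)) * E p.2.
  apply: eq_bigr => p _; rewrite arrow_map_pure3; congr (_ * _ * _).
  exact: (rad_sectionE VP).
have -> : a = \sum_p E p.1 * a * E p.2.
  rewrite -[LHS]mulr1 -[LHS]mul1r -sum_corner_map1 mulr_suml.
  rewrite -(pair_bigA _ (fun j i => E j * a * E i)) /=.
  apply: eq_bigr => j _; rewrite mulr_sumr mulr_sumr.
  by apply: eq_bigr => i _; rewrite mulrA.
rewrite -sumrB.
apply: (sg_sum (H := Subgroup (iprod0 r r) (@iprod_subgroup _ r r))) => p _.
have e : E p.1 * a * E p.2 - E p.1 * (y p.1 p.2 - projv V (y p.1 p.2)) * E p.2 =
    E p.1 * projv V (y p.1 p.2) * E p.2.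
  by rewrite mulrBr mulrBl -yE opprB addrC subrK.
apply: (eq_ind_r (iprod r r) _ e); apply: iprodMr; apply: iprodMl.
exact/VP/memv_proj.
Qed.

(** * The presentation, its surjectivity and its kernel *)

Definition presentation : {rmorphism talg M -> A} :=
  talg_lift_rmorphism arrows_mapD arrows_map_lact arrows_map_ract.

Lemma presentation_tdiag d : presentation (tdiag d) = diag_map d.
Proof. exact: (talg_lift_tin arrows_mapD arrows_map_lact arrows_map_ract). Qed.

Lemma presentation_tgen x : presentation (tgen x) = arrows_map x.
Proof. exact: (talg_lift_tgen arrows_mapD arrows_map_lact arrows_map_ract). Qed.

Lemma presentationZ (c : k) (x : T) : presentation (c *: x) = c *: presentation x.
Proof.
have cE : presentation (tdiag (c *: (1 : D))) = c%:A.
  by rewrite presentation_tdiag /diag_map /= wpsi_scalable epsZ !rmorph1.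
by rewrite -[RHS]mulr_algl -cE -[RHS]rmorphM.
Qed.

Lemma presentation_tideal (x : T) : tideal S x -> r (presentation x).
Proof.
apply: (talg_lift_tplus arrows_mapD arrows_map_lact arrows_map_ract).
exact: arrows_map_rad.
Qed.

(** Successive approximation: an error in [r^n] is improved to one in [r^(n+1)], and at the exponent
    [rl A] it is zero. *)
Lemma presentation_surjective a : exists x, presentation x = a.
Proof.
have step n b : ipow r n b -> exists x, ipow r n.+1 (b - presentation x).
  elim: n b => [|n IHn] b.
    (* The first approximation is diagonal: [eps] lifts the class of [b] modulo the radical. *)
    move=> _; have [g gK Kg] := wpsi_bij W.
    exists (tdiag (g (rproj r b) : D)); apply: ipow1.
    have -> : presentation (tdiag (g (rproj r b) : D)) = eps (rproj r b).
      by rewrite presentation_tdiag; apply: (congr1 (fun q => eps q) (Kg (rproj r b))).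
    by apply/rproj_eq; rewrite epsK.
  move=> [m [c [d [Hcd ->]]]].
  have Hl (l : 'I_m) : exists x, ipow r n.+2 (c l * d l - presentation x).
    (* Approximate [c l] modulo [r^2] and [d l] modulo [r^(n+1)]; the two errors of the product lie
       in [r^2 r^n] and [r r^(n+1)]. *)
    have [rc /IHn[v Hv]] := Hcd l; have [u Hu] := arrows_map_generate rc.
    exists (tgen u * v); rewrite rmorphM presentation_tgen.
    have -> : c l * d l - arrows_map u * presentation v =
        (c l - arrows_map u) * d l + arrows_map u * (d l - presentation v).
      by rewrite mulrBl mulrBr addrA subrK.
    apply: (sgD (H := ipow_sg r n.+2)).
      exact: (@ipowD _ r 2 n _ _ (iprod_ipow2 Hu) (Hcd l).2).
    exact: (@ipowD _ r 1 n.+1 _ _ (ipow1 (arrows_map_rad u)) Hv).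
  have [x Hx] := choice Hl; exists (\sum_l x l).
  rewrite rmorph_sum -sumrB; apply: (sg_sum (H := ipow_sg r n.+2)) => l _.
  exact: Hx.
have approx n : exists x, ipow r n (a - presentation x).
  elim: n => [|n [x /step[y Hy]]]; first by exists 0.
  by exists (x + y); rewrite rmorphD opprD addrA.
have [x] := approx (rl A); rewrite [ipow _ _]ipow_rl => /eqP.
by rewrite subr_eq0 => /eqP ->; exists x.
Qed.

(** Without its component [d] of degree zero, [x] is mapped into the radical, so [eps (wpsi W d)]
    lies there too. Reduction modulo the radical gives [wpsi W d = 0], and [wpsi W] is injective. *)
Lemma presentation_ker (x : T) : presentation x = 0 -> tideal S x.
Proof.
move=> x0; pose d : D := x 0%N.
have : tideal S (x - tdiag d).
  rewrite /tideal /tplus /= -[LHS]/(x 0%N - tdiag d 0%N).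
  by rewrite [tdiag d 0%N]tinE subrr.
move/presentation_tideal; rewrite rmorphB x0 sub0r presentation_tdiag.
move/sgN; rewrite opprK => rd.
have d0 : wpsi W d = 0.
  rewrite -[LHS]epsK -[RHS](zproj0 r); apply/rproj_eq; rewrite subr0; exact: rd.
have /bij_inj inj := wpsi_bij W.
by apply: inj; rewrite [LHS]d0 rmorph0.
Qed.

End Presentation.

(** * Kernels as ideals, and the conclusion *)

Section KernelIdeal.
Variables (R R' : pzRingType) (f : {rmorphism R -> R'}).

Fact ker_ideal0 : f 0 = 0. Proof. exact: rmorph0. Qed.
Fact ker_idealB x y : f x = 0 -> f y = 0 -> f (x - y) = 0.
Proof. by rewrite rmorphB => -> ->; rewrite subrr. Qed.
Fact ker_idealMl a x : f x = 0 -> f (a * x) = 0.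
Proof. by rewrite rmorphM => ->; rewrite mulr0. Qed.
Fact ker_idealMr x a : f x = 0 -> f (x * a) = 0.
Proof. by rewrite rmorphM => ->; rewrite mul0r. Qed.

Definition ker_ideal : ideal R :=
  @Ideal R (@Subgroup R (fun x => f x = 0) ker_ideal0 ker_idealB)
    ker_idealMl ker_idealMr.

End KernelIdeal.

Theorem proposition4p2 (k : fieldType) (A : falgType k)
    (hbasic : basic A) (hsplit : split_algebra A) (W : wedderburn A) :
  exists rho : set (tensor_algebra (enlarged_species W)),
    [/\ set_of_relations rho,
        iso_to_quotient A (gen_ideal rho),
        ipow (tideal (enlarged_species W)) (rl A) `<=` gen_ideal rho &
        gen_ideal rho `<=` tideal (enlarged_species W)].
Proof.
have [eps [epsZ epsK]] := hsplit.
(* The square of the radical is turned into a vector subspace, so that a linear projection onto it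
   is available. *)
have [|V VP] := @subspace_vspace k A
  (Subgroup (iprod0 (rad A) (rad A)) (@iprod_subgroup _ (rad A) (rad A))).
  by move=> c x Hx; rewrite -mulr_algl; apply: iprodMl.
pose T := tensor_algebra (enlarged_species W).
pose phi : {rmorphism T -> A} := presentation epsZ W VP.
pose K : ideal T := ker_ideal phi.
have KJ : K `<=` tideal (enlarged_species W) by exact: presentation_ker.
have genK := relation_ideal_generated KJ.
exists [set x | K x /\ is_relation x]; split.
- by move=> x [].
- apply: (iso_to_quotient_ker (phi := phi)).
  + exact: presentationZ.
  + exact: presentation_surjective.
  + by move=> b; rewrite -[gen_ideal _ b]/(sgset (gen_ideal _) b) genK.
- rewrite genK => x Jx.
  (* The image of [x] lies in the power [rl A] of the radical, which is zero. *)
  have := ipow_rmorphism (presentation_tideal (W := W) epsZ VP) Jx.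
  by rewrite [ipow _ _]ipow_rl.
by rewrite genK.
Qed.
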